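(* Let $\mathcal{K}$ be a knot and assume that the orthogonal Labastida–Mariño–Ooguri–Vafa (LMOV) conjecture holds for $\mathcal{K}$, i.e. that there are integers $N_{\mu,g,\beta}$ (for partitions $\mu\neq 0$, $g\in\mathbb{Z}_{\ge 0}$, $\beta\in\mathbb{Z}$), vanishing for each $\mu$ when $g$ or $|\beta|$ is sufficiently large, such that for every $\mu\ne 0$ $$\frac{\mathfrak{z}_{\mu}[1]^{2}\,\big(g_{\mu}(\mathcal{K};q,t)-g_{\mu}(\mathcal{K};q,-t)\big)}{2[\mu]}=\sum_{g=0}^{\infty}\sum_{\beta\in\mathbb{Z}}N_{\mu,g,\beta}(q-q^{-1})^{g}t^{\beta}.$$ Let $n_{\mu,g,\beta}$ be the integers, vanishing for each $\mu$ when $g$ or $|\beta|$ is sufficiently large, such that for all $\mu\ne0$ and $\beta$ $$\sum_{g=0}^{\infty}N_{\mu,g,\beta}(q-q^{-1})^{g}=\sum_{g=0}^{\infty}n_{\mu,g,\beta}\sum_{k=0}^{g}q^{g-2k}.$$ Then, for $|q|>1$, $$\frac{Z_{CS}^{SO}(\mathcal{K};q,t;w)}{Z_{CS}^{SO}(\mathcal{K};q,-t;w)}=\prod_{\mu\neq 0}\ \prod_{g=0}^{\infty}\ \prod_{\beta\in\mathbb{Z}}\ \prod_{m=1}^{\infty}\ \prod_{k=0}^{g}\left(\frac{\big\langle 1+(q^{-1})^{g-2k+2m}t^{\beta}z^{\mu}\big\rangle}{\big\langle 1-(q^{-1})^{g-2k+2m}t^{\beta}z^{\mu}\big\rangle}\right)^{\frac{m\,n_{\mu,g,\beta}}{\mathfrak{z}_{\mu}}},$$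 where $\mu$ runs over all non-empty partitions.
   Context: **Partitions.** $\mathcal{P}$ is the set of all partitions (Young diagrams), including the empty one, denoted $0$. For $\mu=(\mu_1\ge\dots\ge\mu_\ell>0)$ put $\ell(\mu)=\ell$, $|\mu|=\sum_i\mu_i$, $\mathfrak{z}_\mu=\prod_{j\ge1}j^{m_j}m_j!$ with $m_j$ the number of parts equal to $j$. Put $[n]=q^n-q^{-n}$ and $[\mu]=\prod_{i}[\mu_i]$. For a positive integer $k$, $k\mid\mu$ means that $k$ divides every part of $\mu$, and then $\mu/k=(\mu_1/k,\mu_2/k,\dots)$. **Orthogonal quantum group invariants.** Let $\mathfrak{g}=so_{2N+1}$ and $t=q^{2N}$. A Young diagram $A$ labels the irreducible $U_q(so_{2N+1})$-module $V_A$ whose highest weight $\Lambda_A$ corresponds to $A$. Present $\mathcal K$ as the closure of a braid on $m$ strands, color all strands by $V_A$, and let each braid generator $\sigma_i^{\pm1}$ act on $V_A^{\otimes m}$ by $\check R^{\pm1}$ in positions $i,i+1$, where $\check R=P_{12}R$, $R$ is the universal $R$-matrix and $P_{12}$ is the flip; call the resulting operator $\pi(\mathcal K)$. Then $$W_A^{SO}(\mathcal K;q,t)=q^{d(\mathcal K)}\,\mathrm{Tr}_{V_A^{\otimes m}}(\mu^{\otimes m}\,\pi(\mathcal K)),\qquad d(\mathcal K)=-\omega(\mathcal K)(\Lambda_A,\Lambda_A+2\rho),$$ where in this formula $\mu$ is the element of the Cartan part associated with the Weyl vector $\rho$ that defines the quantum trace (so that $W_A^{SO}$ of the unknot is the quantum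 dimension of $V_A$), and $\omega(\mathcal K)$ is the writhe of the diagram. It is regarded as a function of $q$ and $t$ (the colored Kauffman polynomial); for $A=(1)$ it is the Kauffman polynomial up to the universal factor $1+\frac{t-t^{-1}}{q-q^{-1}}$. **Brauer algebra characters.** $Br_n$ is the (semisimple) Brauer algebra, containing $\mathbb{C}[S_n]$. Its set of irreducible representations $\widehat{Br}_n$ is labeled by the partitions of $n-2k$, $k=0,1,\dots,\lfloor n/2\rfloor$. For $A\in\widehat{Br}_n$, $\chi_A$ is its character, and for $\mu\vdash n$, $\gamma_\mu\in S_n\subset Br_n$ is a permutation of cycle type $\mu$. **Partition function and reformulated invariants.** For variables $z=\{z_i\}_{-\infty<i<\infty}$ let $pb_n(z)=\sum_{i=-\infty}^{\infty}z_i^n$ and $pb_\mu(z)=\prod_{i=1}^{\ell(\mu)}pb_{\mu_i}(z)$. The orthogonal Chern–Simons partition function is $$Z_{CS}^{SO}(\mathcal K;q,t;z)=\sum_{\mu\in\mathcal P}\frac{pb_\mu(z)}{\mathfrak z_\mu}\sum_{A\in\widehat{Br}_{|\mu|}}\chi_A(\gamma_\mu)\,W^{SO}_A(\mathcal K;q,t).$$ Its logarithm is expanded as $\log Z_{CS}^{SO}(\mathcal K;q,t;z)=\sum_{\mu\ne0}F_\mu(\mathcal K;q,t)\,pb_\mu(z)$, and $$g_\mu(\mathcal K;q,t)=\sum_{k\mid\mu}\frac{\mu(k)}{k}F_{\mu/k}(\mathcal K;q^k,t^k),$$ where $\mu(k)$ is the Möbius function. Replacing $t$ by $-t$ means substituting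 $-t$ for $t$ in these functions of $(q,t)$. **The variables $w$.** $w=z*q^\rho$ denotes the specialization determined by $pb_n(w)=pb_n(z)/[n]$ for all $n\ge1$, hence $pb_\mu(w)=pb_\mu(z)/[\mu]$; thus $Z_{CS}^{SO}(\mathcal K;q,t;w)$ is obtained from $Z_{CS}^{SO}(\mathcal K;q,t;z)$ by replacing each $pb_\mu(z)$ by $pb_\mu(z)/[\mu]$. **Symmetric product.** For a quantity $\omega$ and a partition $\mu$, $$\big\langle1\pm\omega z^\mu\big\rangle=\prod_{i_1,\dots,i_{\ell(\mu)}\in\mathbb{Z}}\big(1\pm\omega z_{i_1}^{\mu_1}\cdots z_{i_{\ell(\mu)}}^{\mu_{\ell(\mu)}}\big).$$ The product formula is an identity of formal series in the variables $z_i$ with constant term $1$; rational powers are defined by $f^{r}=\exp(r\log f)$, and rational functions of $q$ are expanded in $|q|>1$. *)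

(* Defs.v *)
From HB Require Import structures.
From mathcomp Require Import all_boot all_order all_algebra.
From mathcomp Require Import all_fingroup mxrepresentation.
From mathcomp Require Import finmap multiset mxtens.
From mathcomp Require Import boolp classical_sets functions fsbigop.

Set Implicit Arguments.
Unset Strict Implicit.
Unset Printing Implicit Defensive.

Import Order.TTheory GRing.Theory Num.Theory.
Local Open Scope ring_scope.

Definition is_partition (mu : seq nat) : bool := sorted geq mu && (0%N \notin mu).

Definition zee (mu : seq nat) : nat :=
  (\prod_(1 <= j < (sumn mu).+1) (j ^ count_mem j mu * (count_mem j mu)`!))%N.

Definition part_div (mu : seq nat) (k : nat) : seq nat := [seq (i %/ k)%N | i <- mu].

(** Only used for [n >= 1]. *)
Definition moebius (n : nat) : int :=
  if all (fun p => logn p n == 1%N) (primes n) then (-1) ^+ size (primes n) else 0.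

(** Numerators and denominators are polynomials in [q] whose coefficients are
    polynomials in [t]. *)
Notation Qqt := {fraction {poly {poly rat}}}.
Definition q : Qqt := tofrac 'X.
Definition t : Qqt := tofrac ('X)%:P.

Definition qnum (n : nat) : Qqt := q ^+ n - q ^- n.
Definition qpart (mu : seq nat) : Qqt := \prod_(i <- mu) qnum i.

Definition eval2 (L : fieldType) (p : {poly {poly rat}}) (a b : L) : L :=
  (map_poly (fun c : {poly rat} => (map_poly ratr c).[b]) p).[a].

(** The value of a rational function at [q = a], [t = b]; meaningful when the
    denominator does not vanish at [(a, b)]. *)
Definition subst (L : fieldType) (x : Qqt) (a b : L) : L :=
  let r := generic_quotient.repr x in eval2 (\n_r) a b / eval2 (\d_r) a b.

(** [x = O(q^-B)] as [q] tends to infinity: the expansion of [x] in the region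
    [|q| > 1], i.e. as a Laurent series in [1/q], starts at order at least [B]. *)
Definition qsmall (B : nat) (x : Qqt) : Prop :=
  exists u v : {poly {poly rat}},
    [/\ v != 0, x = tofrac u / tofrac v & (size u + B <= size v)%N].

(** The base field Q(s), where s is a square root of q; the root is needed
    because the short simple root of so(2N+1) has q_i = q^(1/2). *)
Notation Qs := {fraction {poly rat}}.
Definition s : Qs := tofrac 'X.

Section QuantumSO.
Variable N : nat.

(** Weights are given by their coordinates in the orthonormal basis
    eps_0, ..., eps_(N-1); the simple roots of so(2N+1) are
    alpha_i = eps_i - eps_(i+1) for i < N-1 and alpha_(N-1) = eps_(N-1). *)
Definition weight := 'I_N -> int.
Definition wform (x y : weight) : int := \sum_j x j * y j.
Definition alpha (i : 'I_N) : weight := fun j => (j == i)%:Z - (j == i.+1 :> nat)%:Z.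
Definition two_rho : weight := fun i => (2 * N)%:Z - 1 - (2 * i)%:Z.
Definition cartan (i j : 'I_N) : int :=
  (2 * wform (alpha i) (alpha j) %/ wform (alpha i) (alpha i))%Z.
Definition part_weight (A : seq nat) : weight := fun i => (nth 0%N A i)%:Z.

Definition q_ (i : 'I_N) : Qs := s ^ wform (alpha i) (alpha i).
Definition qint (i : 'I_N) (n : nat) : Qs :=
  (q_ i ^+ n - q_ i ^- n) / (q_ i - (q_ i)^-1).
Definition qfact (i : 'I_N) (n : nat) : Qs := \prod_(1 <= k < n.+1) qint i k.
Definition qbin (i : 'I_N) (n k : nat) : Qs :=
  qfact i n / (qfact i k * qfact i (n - k)).

Section Modules.
Variable d : nat.

(** Matrices act on column vectors. *)
Record generators := Generators {
  genE : 'I_N -> 'M[Qs]_d;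
  genF : 'I_N -> 'M[Qs]_d;
  genK : 'I_N -> 'M[Qs]_d }.

(** A module presented in a basis of weight vectors; the a-th basis vector has
    weight [wt a]. *)
Record weight_module := WeightModule {
  wt : 'I_d -> weight;
  opE : 'I_N -> 'M[Qs]_d;
  opF : 'I_N -> 'M[Qs]_d }.

(** The diagonal operator [q^lambda], with [q = s^2]. *)
Definition q_weight (M : weight_module) (lambda : weight) : 'M[Qs]_d :=
  diag_mx (\row_a s ^ (2 * wform lambda (wt M a))).

Definition gens_of (M : weight_module) : generators :=
  Generators (opE M) (opF M) (fun i => q_weight M (alpha i)).

Definition serre (X : 'I_N -> 'M[Qs]_d) (i j : 'I_N) : 'M[Qs]_d :=
  let m := `|1 - cartan i j|%N in
  \sum_(r < m.+1) ((-1) ^+ r * qbin i m r) *: (X i ^+ (m - r) * X j * X i ^+ r).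

Definition Uq_relations (G : generators) : Prop :=
  let: Generators E F K := G in
  [/\ forall i j, K i \in unitmx /\ K i * K j = K j * K i,
      forall i j, K i * E j = s ^ (2 * wform (alpha i) (alpha j)) *: (E j * K i),
      forall i j, K i * F j = s ^ (- (2 * wform (alpha i) (alpha j))) *: (F j * K i),
      forall i j, E i * F j - F j * E i =
        if i == j then (q_ i - (q_ i)^-1)^-1 *: (K i - invmx (K i)) else 0
    & forall i j, i != j -> serre E i j = 0 /\ serre F i j = 0].

(** Lusztig's braid group automorphism T_i, in terms of the images of the
    generators. *)
Definition lusztig (i : 'I_N) (G : generators) : generators :=
  let: Generators E F K := G in
  let dp (X : 'I_N -> 'M[Qs]_d) r := (qfact i r)^-1 *: X i ^+ r in
  Generators
    (fun j => if j == i then - (F i * K i) else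
       let m := `|cartan i j|%N in
       \sum_(r < m.+1) ((-1) ^+ (r + m) * q_ i ^- r) *: (dp E (m - r)%N * E j * dp E r))
    (fun j => if j == i then - (invmx (K i) * E i) else
       let m := `|cartan i j|%N in
       \sum_(r < m.+1) ((-1) ^+ (r + m) * q_ i ^+ r) *: (dp F r * F j * dp F (m - r)%N))
    (fun j => if j == i then invmx (K i) else K j * K i ^+ `|cartan i j|%N).

(** The factor exp_(q_i)((1 - q_i^-2) E (x) F) of the R-matrix; the sum can be
    truncated since E is nilpotent. *)
Definition qexp_factor (i : 'I_N) (E F : 'M[Qs]_d) : 'M[Qs]_(d * d) :=
  \sum_(k < d.+1)
    (q_ i ^+ 'C(k.+1, 2) / qfact i k * (1 - q_ i ^- 2) ^+ k) *: (E ^+ k *t F ^+ k).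

(** If the word is i_1 ... i_l, the r-th factor is built from the root vectors
    T_(i_1) ... T_(i_(r-1)) (E_(i_r)) and T_(i_1) ... T_(i_(r-1)) (F_(i_r)). *)
Fixpoint quasi_R (word : seq 'I_N) (G : generators) : 'M[Qs]_(d * d) :=
  if word is i :: word' then
    qexp_factor i (genE G i) (genF G i) * quasi_R word' (lusztig i G)
  else 1.

(** (s_0 s_1 ... s_(N-1))^N is a reduced expression of the longest element of
    the Weyl group. *)
Definition longest_word : seq 'I_N := flatten (nseq N (enum 'I_N)).

(** The universal R-matrix
      q^(sum_ij (B^-1)_ij H_i (x) H_j) * prod_beta exp_(q_beta)((1 - q_beta^-2) E_beta (x) F_beta)
    on V (x) V, for the coproduct with Delta(E_i) = E_i (x) K_i + 1 (x) E_i and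
    Delta(F_i) = F_i (x) 1 + K_i^-1 (x) F_i; its first factor multiplies a tensor
    product of vectors of weights lambda, mu by q^(lambda, mu). *)
Definition R_matrix (M : weight_module) : 'M[Qs]_(d * d) :=
  diag_mx (\row_x let ab := mxtens_unindex x in
                  s ^ (2 * wform (wt M ab.1) (wt M ab.2)))
  * quasi_R longest_word (gens_of M).

Definition flip_mx : 'M[Qs]_(d * d) :=
  \matrix_(x, y) (mxtens_unindex x == ((mxtens_unindex y).2, (mxtens_unindex y).1))%:R.

Definition R_check (M : weight_module) : 'M[Qs]_(d * d) := flip_mx * R_matrix M.

End Modules.
End QuantumSO.

(** A family of matrices acting irreducibly (on row vectors). *)
Definition mx_simple (F : fieldType) d (S : 'M[F]_d -> Prop) : Prop :=
  (0 < d)%N /\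
  forall U : 'M[F]_d, (forall f, S f -> stablemx U f) -> U = 0 \/ row_full U.

(** [M] is the irreducible U_q(so(2N+1))-module V_A. *)
Definition is_VA N d (M : weight_module N d) (A : seq nat) : Prop :=
  [/\ (size A <= N)%N,
      Uq_relations (gens_of M),
      mx_simple (fun f => exists i : 'I_N,
        [\/ f = (opE M i)^T, f = (opF M i)^T | f = (q_weight M (alpha i))^T])
    & exists a : 'I_d, wt M a = part_weight A /\ forall i, col a (opE M i) = 0].

(** A word in the generators of the braid group on [m.+1] strands; [(i, true)]
    and [(i, false)] stand for sigma_i and its inverse. *)
Definition braid m := seq ('I_m * bool).

Definition strandl m (i : 'I_m) : 'I_m.+1 := inord i.
Definition strandr m (i : 'I_m) : 'I_m.+1 := inord i.+1.

Definition braid_perm m (b : braid m) : 'S_m.+1 :=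
  (\prod_(x <- b) tperm (strandl x.1) (strandr x.1))%g.

Definition closure_is_knot m (b : braid m) : Prop := #|porbits (braid_perm b)| = 1%N.

Definition writhe m (b : braid m) : int := \sum_(x <- b) (if x.2 then 1 else -1).

(** The basis of the [m.+1]-st tensor power of a [d]-dimensional space. *)
Notation tensor_basis m d := {ffun 'I_m.+1 -> 'I_d}.

Definition two_strand_op m d (C : 'M[Qs]_(d * d)) (i : 'I_m) : 'M[Qs]_#|tensor_basis m d| :=
  \matrix_(x, y)
    let a : tensor_basis m d := enum_val x in
    let b : tensor_basis m d := enum_val y in
    C (mxtens_index (a (strandl i), a (strandr i)))
      (mxtens_index (b (strandl i), b (strandr i)))
    * [forall k, [|| k == strandl i, k == strandr i | a k == b k]]%:R.

Definition tensor_power m d (C : 'M[Qs]_d) : 'M[Qs]_#|tensor_basis m d| :=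
  \matrix_(x, y) \prod_k
    C ((enum_val x : tensor_basis m d) k) ((enum_val y : tensor_basis m d) k).

Definition braid_op m N d (M : weight_module N d) (b : braid m)
    : 'M[Qs]_#|tensor_basis m d| :=
  \prod_(x <- b)
    two_strand_op (if x.2 then R_check M else invmx (R_check M)) x.1.

(** The invariant of the closure of [b] coloured by [M = V_A]. *)
Definition so_trace m N d (M : weight_module N d) (A : seq nat) (b : braid m) : Qs :=
  let L := @part_weight N A in
  s ^ (2 * (- writhe b * wform L (fun i => L i + two_rho i)))
  * \tr (tensor_power m (q_weight M (@two_rho N)) * braid_op M b).

(** [x] is the colored Kauffman polynomial of the closure of [b]: the rational
    function of [q] and [t] giving the U_q(so(2N+1)) invariant at [t = q^(2N)],
    for [N] large. *)
Definition is_W_SO m (b : braid m) (A : seq nat) (x : Qqt) : Prop :=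
  exists N0, forall N, (N0 <= N)%N ->
  forall d (M : weight_module N d), is_VA M A ->
    subst x (s ^+ 2) (s ^+ (4 * N)) = so_trace M A b.

Section Brauer.
(** The Brauer algebra is taken with an indeterminate parameter, for which it is
    semisimple. *)
Notation Qdelta := {fraction {poly rat}}.
Definition delta : Qdelta := tofrac 'X.

Variables (n d : nat).

(** [brE i j] is the action of the diagram whose only non-vertical arcs join
    points [i] and [j] at the top and at the bottom. The relations, imposed on all
    pairs of points, amount to the usual ones between adjacent transpositions and
    adjacent contractions. *)
Record brauer_rep := BrauerRep {
  brS : mx_representation Qdelta [set: 'S_n]%G d;
  brE : 'I_n -> 'I_n -> 'M[Qdelta]_d;
  brE_sym : forall i j, brE i j = brE j i;
  brE_conj : forall (g : 'S_n) i j, i != j -> brE i j * brS g = brS g * brE (g i) (g j);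
  brE_idem : forall i j, i != j -> brE i j * brE i j = delta *: brE i j;
  brE_tperm : forall i j, i != j -> brS (tperm i j) * brE i j = brE i j;
  brE_comm : forall i j k l, uniq [:: i; j; k; l] ->
    brE i j * brE k l = brE k l * brE i j;
  brE_chain : forall i j k, uniq [:: i; j; k] ->
    brE i j * brE j k = brS (tperm i k) * brE j k }.

Variable rho : brauer_rep.

Definition brauer_irreducible : Prop :=
  mx_simple (fun f => (exists g, f = brS rho g) \/
                      (exists i j, i != j /\ f = brE rho i j)).

(** The diagram with arcs (r, r+1), (r+2, r+3), ..., (n-2, n-1) at the top and at
    the bottom; used when [n - r] is even. *)
Definition arcs (r : nat) : 'M[Qdelta]_d :=
  \prod_(i < n | (r <= i)%N && ~~ odd (i - r)) brE rho i (ordS i).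

(** The points 0, ..., |A|-1 fill the Young diagram A row after row;
    [reshape_index A x] and [reshape_offset A x] are the row and column of x. *)
Definition pos_stab (A : seq nat) (pos : nat -> nat) : pred 'S_n :=
  fun g => [forall x : 'I_n,
    if (x < sumn A)%N then (g x < sumn A)%N && (pos (g x) == pos x) else g x == x].

Definition young_symmetrizer (A : seq nat) : 'M[Qdelta]_d :=
  (\sum_(g | pos_stab A (reshape_index A) g) brS rho g)
  * (\sum_(g | pos_stab A (reshape_offset A) g) (-1) ^+ g *: brS rho g).

(** [rho] is the irreducible representation labelled by a partition [A] of
    [n - 2k]: diagrams with [k+1] arcs act by zero, and the image of the diagram
    with [k] arcs is the Specht module of [A]. *)
Definition brauer_label (A : seq nat) : Prop :=
  [/\ brauer_irreducible,
      (2 <= sumn A)%N -> arcs (sumn A - 2) = 0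
    & young_symmetrizer A * arcs (sumn A) != 0].

End Brauer.

Definition cycle_type n (g : 'S_n) (mu : seq nat) : Prop :=
  perm_eq [seq #|pred_of_set C| | C <- enum (porbits g)] mu.

(** The value at a permutation of cycle type [mu] of the character of the
    irreducible representation of the Brauer algebra labelled by [A]; the values
    at permutations are integers. *)
Definition brauer_char (A mu : seq nat) : int :=
  xget 0 (fun c : int =>
    exists d (rho : brauer_rep (sumn mu) d) (g : 'S_(sumn mu)),
      [/\ brauer_label rho A, cycle_type g mu & \tr (brS rho g) = c%:~R]).

Local Open Scope classical_set_scope.

(** A monomial is a multiset of indices, a series is the family of its
    coefficients. *)
Definition monomial := {mset int}%mset.
Definition series := monomial -> Qqt.

Definition mdeg (e : monomial) : nat := size (enum_mset e).

Definition s1 : series := fun e => (e == mset0)%:R.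
Definition sadd (f g : series) : series := fun e => f e + g e.
Definition sscale (c : Qqt) (f : series) : series := fun e => c * f e.
Definition ssub (f g : series) : series := fun e => f e - g e.
Definition smul (f g : series) : series :=
  fun e => \sum_(d \in [set d : monomial | (d `<=` e)%mset]) f d * g (e `\` d)%mset.
Definition sexpn (f : series) (n : nat) : series := iter n (smul f) s1.

(** Inverse, logarithm and rational powers of series with constant term 1,
    exponential of series with constant term 0. The power series that define them
    are truncated at a degree beyond which they do not contribute to the
    coefficient of [e]. *)
Definition sinv (f : series) : series :=
  fun e => \sum_(n < (mdeg e).+1) sexpn (ssub s1 f) n e.
Definition slog (f : series) : series :=
  fun e => \sum_(1 <= n < (mdeg e).+1) (-1) ^+ n.-1 / n%:R * sexpn (ssub f s1) n e.
Definition sexp (f : series) : series :=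
  fun e => \sum_(n < (mdeg e).+1) (n`!%:R)^-1 * sexpn f n e.
Definition sdiv (f g : series) : series := smul f (sinv g).
Definition spow (f : series) (r : rat) : series := sexp (sscale (ratr r) (slog f)).

(** [F] is the unordered infinite product of the [f i], [i] in [D]: each
    coefficient of the finite partial products converges to that of [F], for the
    topology given by expansion in powers of [1/q]. *)
Definition has_prod (I : choiceType) (D : set I) (f : I -> series) (F : series) : Prop :=
  forall (e : monomial) (B : nat),
  exists S0 : {fset I}, [set` S0] `<=` D /\
  forall S : {fset I}, [set` S0] `<=` [set` S] -> [set` S] `<=` D ->
    qsmall B ((\big[smul/s1]_(i <- S) f i) e - F e).

Definition sprod (I : choiceType) (f : I -> series) : series :=
  xget s1 [set F | has_prod [set: I] f F].

Definition zvar_pow (n : nat) (i : int) : monomial := msetn n i.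

(** The monomial z_(i_1)^(mu_1) ... z_(i_l)^(mu_l). *)
Definition zmon (mu : seq nat) (i : seq int) : monomial :=
  seq_mset (flatten [seq nseq p.1 p.2 | p <- zip mu i]).

(** The symmetric product < 1 + omega z^mu >. *)
Definition bracket (omega : Qqt) (mu : seq nat) : series :=
  sprod (fun i : (size mu).-tuple int =>
    sadd s1 (fun e => omega * (e == zmon mu i)%:R)).

Definition pbz (n : nat) : series :=
  fun e => \sum_(i \in [set: int]) ((e == zvar_pow n i)%:R : Qqt).

(** The power sums of the variables w = z * q^rho. *)
Definition pbw (n : nat) : series := sscale (qnum n)^-1 (pbz n).

Definition pbprod (p : nat -> series) (mu : seq nat) : series :=
  \big[smul/s1]_(i <- mu) p i.

Definition partitions : set (seq nat) := [set mu | is_partition mu].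
Definition nonempty_partitions : set (seq nat) :=
  [set mu | is_partition mu /\ mu <> [::]].

Definition brauer_hat (n : nat) : set (seq nat) :=
  [set A | is_partition A /\ exists k, (sumn A + 2 * k)%N = n].

Definition Z_CS (W : seq nat -> Qqt) (p : nat -> series) : series :=
  fun e => \sum_(mu \in partitions)
    ((zee mu)%:R^-1 * \sum_(A \in brauer_hat (sumn mu)) (brauer_char A mu)%:~R * W A)
    * pbprod p mu e.

Definition neg_t (x : Qqt) : Qqt := subst x q (- t).

Definition log_expansion (Z : series) (F : seq nat -> Qqt) : Prop :=
  slog Z = fun e => \sum_(mu \in nonempty_partitions) F mu * pbprod pbz mu e.

Definition reform_g (F : seq nat -> Qqt) (mu : seq nat) : Qqt :=
  \sum_(1 <= k < (sumn mu).+1 | all (fun i => k %| i)%N mu)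
    (moebius k)%:~R / k%:R * subst (F (part_div mu k)) (q ^+ k) (t ^+ k).

Definition eventually_zero (c : nat -> int -> int) : Prop :=
  exists B : nat, forall g beta, (B <= g)%N || (B <= `|beta|)%N -> c g beta = 0.

(** The orthogonal LMOV conjecture, with integers [Nc mu g beta]. *)
Definition LMOV_SO (F : seq nat -> Qqt) (Nc : seq nat -> nat -> int -> int) : Prop :=
  forall mu, nonempty_partitions mu ->
  eventually_zero (Nc mu) /\
  (zee mu)%:R * qnum 1 ^+ 2 * (reform_g F mu - neg_t (reform_g F mu)) / (2 * qpart mu)
  = \sum_(g \in [set: nat]) \sum_(beta \in [set: int])
      (Nc mu g beta)%:~R * (q - q^-1) ^+ g * t ^ beta.

Definition refined_integers (Nc nc : seq nat -> nat -> int -> int) : Prop :=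
  forall mu, nonempty_partitions mu ->
  eventually_zero (nc mu) /\
  forall beta,
    \sum_(g \in [set: nat]) (Nc mu g beta)%:~R * (q - q^-1) ^+ g
    = \sum_(g \in [set: nat])
        (nc mu g beta)%:~R * \sum_(k < g.+1) q ^ (g%:Z - 2 * k%:Z).

(* Main.v *)
From HB Require Import structures.
Require Import Defs.
From mathcomp Require Import all_boot all_order all_algebra.
From mathcomp Require Import all_fingroup mxrepresentation.
From mathcomp Require Import finmap multiset mxtens.
From mathcomp Require Import boolp classical_sets functions fsbigop cardinality.
From mathcomp Require Import zify ring.

(** The product formula holds because its two sides have the same logarithm.

    Let [p_mu] denote the products of power sums. The substitution [w] multiplies
    each [p_mu] by [1/[mu]]. As the [p_mu] are linearly independent ([Psi_inj]),
    the expansion of [log Z] at [z] is a family of identities between coefficients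
    ([log_coefs_is_log]); these identities survive the rescaling of the [p_mu]
    and the automorphism [t -> -t] ([is_log_Psi], [rmorph_log_coefs]), so that
    the logarithm of the left-hand side is the sum of
    [(F_mu(q,t) - F_mu(q,-t)) p_mu / [mu]] ([is_log_quotient]). Moebius inversion
    writes [F_mu] as the sum, over the common divisors [k] of the parts of [mu],
    of [g_(mu/k)(q^k,t^k) / k] ([reform_gK]); the terms with [k] even are
    invariant under [t -> -t] and cancel ([odd_part_F]). The LMOV hypothesis,
    rewritten with the integers [n], turns the logarithm into a sum over
    partitions [nu] and odd [k] of
    [2 / (k z_nu [k]^2) * sum n_(nu,g,beta) (q^(g-2j) t^beta)^k * p_(k nu)]
    ([log_quotient_coef]).

    On the right-hand side, [log <1 + omega z^nu>] is the alternating sum of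
    [omega^k p_(k nu) / k] ([has_pprod_bracket]), hence the logarithm of
    [<1 + omega z^nu> / <1 - omega z^nu>] is twice the sum over odd [k]
    ([bracket_log_odd]). The product over [m] then supplies the factor
    [1/[k]^2], which is the sum of [m q^(-2km)] ([tends_weighted_geometric],
    [geometric_qnum]). For a given monomial only finitely many [nu], [g], [beta]
    and [k] matter; [m] is the only index along which there is a genuine limit.

    Logarithms are handled through the Euler derivation [D], which multiplies
    monomials by their degree: [L] is the logarithm of [f] when [f(0) = 1],
    [L(0) = 0] and [D f = f D L] ([is_log]). This relation is additive, it
    holds for the logarithms, exponentials and rational powers that are defined by
    truncated power series, and it expresses each coefficient of [f] as a polynomial
    in those of [L] and in lower ones of [f]. Hence an infinite product converges
    as soon as the sum of the logarithms of its factors does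
    ([has_pprod_is_log]).

    The partition function has constant term 1 because the invariant coloured by
    the empty partition is 1: it is computed with the trivial module for all [N],
    and a rational function of [q] and [t] is determined by its values at
    [t = q^(2N)] for [N] large ([W_nil]). *)

Set Implicit Arguments.
Unset Strict Implicit.
Unset Printing Implicit Defensive.

Import Order.TTheory GRing.Theory Num.Theory.
Local Open Scope ring_scope.
Local Open Scope classical_set_scope.

(** * Power series in the variables z_i *)

Lemma finite_submsets (e : monomial) : finite_set [set d : monomial | (d `<=` e)%mset].
Proof.
rewrite -[e]seq_mset_id; elim: (enum_mset e) => [|a r IH].
  apply: (@sub_finite_set _ _ [set mset0]); last exact: finite_set1.
  move=> d /=; suff -> : seq_mset [::] = (mset0 : monomial) by rewrite msubset0 => /eqP.
  by apply/msetP => x; rewrite mset_seqE mset0E.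
rewrite mset_cons; set e' := seq_mset r in IH *.
apply: (@sub_finite_set _ _
  ([set d | (d `<=` e')%mset] `|` [set (a +` d)%mset | d in [set d | (d `<=` e')%mset]])).
  move=> d /= /msubsetP dle.
  have [da|da] := boolP (a \in d); last first.
    left; apply/msubsetP => x; have := dle x; rewrite mset1DE.
    by case: eqVneq => // -> _; move: da; rewrite -mset_eq0 => /eqP ->.
  right; exists (d `\ a)%mset; last exact: msetB1K.
  apply/msubsetP => x; have := dle x; rewrite mset1DE msetB1E; lia.
by rewrite finite_setU; split=> //; apply: finite_image.
Qed.

Definition msub (e : monomial) : seq monomial :=
  fset_set [set d : monomial | (d `<=` e)%mset].

Lemma mem_msub e d : (d \in msub e) = (d `<=` e)%mset.
Proof.
rewrite /msub in_fset_set ?inE //; last exact: finite_submsets.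
by apply/idP/idP; rewrite in_setE.
Qed.

Lemma msub_uniq e : uniq (msub e).
Proof. exact: fset_uniq. Qed.

Lemma mdegD (d e : monomial) : mdeg (d `+` e)%mset = (mdeg d + mdeg e)%N.
Proof.
rewrite /mdeg; have /perm_size -> : perm_eq (d `+` e)%mset (enum_mset d ++ enum_mset e).
  apply/allP => x _ /=; rewrite count_cat !count_mem_mset msetE2; exact/eqP.
by rewrite size_cat.
Qed.

Lemma mdegB (d e : monomial) : (d `<=` e)%mset -> mdeg e = (mdeg d + mdeg (e `\` d)%mset)%N.
Proof. by move=> le; rewrite -mdegD msetBDKC. Qed.

Lemma mdeg0 : mdeg mset0 = 0%N.
Proof. by rewrite /mdeg enum_mset0. Qed.

Lemma mdeg_eq0 e : (mdeg e == 0%N) = (e == mset0).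
Proof. exact: size_mset_eq0. Qed.

Section PowerSeries.
Variable K : fieldType.

(** Over the field [Qqt] the operations below are convertible to those on
    [series]. The coefficients are taken in an abstract field because conversion
    problems between elements of a concrete field of fractions are very slow to
    decide. *)
Definition pseries (R : Type) := monomial -> R.

Implicit Types f g h : pseries K.

Definition p0 : pseries K := fun _ => 0.
Definition p1 : pseries K := fun e => (e == mset0)%:R.
Definition padd f g : pseries K := fun e => f e + g e.
Definition popp f : pseries K := fun e => - f e.
Definition pmul f g : pseries K :=
  fun e => \sum_(d \in [set d : monomial | (d `<=` e)%mset]) f d * g (e `\` d)%mset.

Lemma pmulE (f g : pseries K) e :
  pmul f g e = \sum_(d <- msub e) f d * g (e `\` d)%mset.
Proof. by rewrite /pmul fsbig_finite //; apply: finite_submsets. Qed.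

Lemma pmulC : commutative pmul.
Proof.
move=> f g; apply/funext => e; rewrite !pmulE.
have P : perm_eq [seq (e `\` d)%mset | d <- msub e] (msub e).
  apply: uniq_perm; last 1 first.
  - move=> d; rewrite mem_msub; apply/mapP/idP => [[c _ ->]|dle].
      exact: msubsetDl.
    by exists (e `\` d)%mset; rewrite ?mem_msub ?msubsetDl ?msetBBK.
  - rewrite map_inj_in_uniq ?msub_uniq // => c d.
    by rewrite !mem_msub => cle dle E; rewrite -(msetBBK cle) E msetBBK.
  - exact: msub_uniq.
rewrite -(perm_big _ P) big_map; apply: eq_big_seq => d.
by rewrite mem_msub => dle; rewrite msetBBK // mulrC.
Qed.

Lemma msub_shift (d e : monomial) : (d `<=` e)%mset ->
  perm_eq [seq c <- msub e | (d `<=` c)%mset] [seq (d `+` c)%mset | c <- msub (e `\` d)%mset].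
Proof.
move=> dle; apply: uniq_perm.
- by rewrite filter_uniq ?msub_uniq.
- rewrite map_inj_in_uniq ?msub_uniq // => b c _ _ E.
  by have := congr1 (fun m => (m `\` d)%mset) E; rewrite ![(d `+` _)%mset]msetDC !msetDKBC.
move=> c; rewrite mem_filter mem_msub; apply/andP/mapP => [[dc ce]|[b]].
  exists (c `\` d)%mset; last by rewrite msetBDKC.
  by rewrite mem_msub msetSB.
rewrite mem_msub => be ->; split.
  by rewrite -{1}[d]msetD0 msetDS // msub0set.
by rewrite -(msetBDKC dle) msetDS.
Qed.

Lemma pmulA : associative pmul.
Proof.
move=> f g h; apply/funext => e; rewrite [in LHS]pmulE [in RHS]pmulE.
pose G d c := f d * g (c `\` d)%mset * h (e `\` c)%mset.
transitivity (\sum_(d <- msub e) \sum_(c <- msub e | (d `<=` c)%mset) G d c).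
  apply: eq_big_seq => d; rewrite mem_msub => dle; rewrite pmulE mulr_sumr.
  rewrite -[RHS]big_filter (perm_big _ (msub_shift dle)) big_map; apply: eq_bigr => c _.
  by rewrite /G msetDC msetDKBC [(c `+` d)%mset]msetDC msetBDA mulrA.
rewrite (exchange_big_dep xpredT) //=; apply: eq_big_seq => c; rewrite mem_msub => ce.
rewrite pmulE mulr_suml -[LHS]big_filter; apply: perm_big; apply: uniq_perm.
- by rewrite filter_uniq ?msub_uniq.
- exact: msub_uniq.
move=> d; rewrite mem_filter !mem_msub.
by apply/andP/idP => [[]//|dc]; split=> //; apply: msubset_trans ce.
Qed.

Lemma pmul1 : left_id p1 pmul.
Proof.
move=> f; apply/funext => e; rewrite pmulE (bigD1_seq mset0) ?msub_uniq //=; last first.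
  by rewrite mem_msub msub0set.
rewrite /p1 eqxx mul1r msetB0 big1 ?addr0 // => d /negPf ->.
by rewrite mul0r.
Qed.

Lemma pmulDl : left_distributive pmul padd.
Proof.
move=> f g h; apply/funext => e; rewrite /padd !pmulE -big_split.
by apply: eq_bigr => d _; rewrite mulrDl.
Qed.

HB.instance Definition _ := gen_eqMixin (pseries K).
HB.instance Definition _ := gen_choiceMixin (pseries K).

Lemma paddA : associative padd.
Proof. by move=> f g h; apply/funext => e; exact: addrA. Qed.
Lemma paddC : commutative padd.
Proof. by move=> f g; apply/funext => e; exact: addrC. Qed.
Lemma padd0 : left_id p0 padd.
Proof. by move=> f; apply/funext => e; exact: add0r. Qed.
Lemma paddN : left_inverse p0 popp padd.
Proof. by move=> f; apply/funext => e; exact: addNr. Qed.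

HB.instance Definition _ := GRing.isZmodule.Build (pseries K) paddA paddC padd0 paddN.

Lemma p1_neq0 : p1 != 0 :> pseries K.
Proof.
apply/eqP => /(congr1 (@^~ mset0)); rewrite /p1 eqxx => /eqP.
by rewrite oner_eq0.
Qed.

HB.instance Definition _ :=
  GRing.Zmodule_isComNzRing.Build (pseries K) pmulA pmulC pmul1 pmulDl p1_neq0.

Lemma cf0 e : (0 : pseries K) e = 0. Proof. by []. Qed.
Lemma cfD (f g : pseries K) e : (f + g) e = f e + g e. Proof. by []. Qed.
Lemma cfN (f : pseries K) e : (- f) e = - f e. Proof. by []. Qed.
Lemma cfM (f g : pseries K) e :
  (f * g) e = \sum_(d <- msub e) f d * g (e `\` d)%mset.
Proof. exact: pmulE. Qed.
Lemma cf_sum I (r : seq I) P (F : I -> pseries K) e :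
  (\sum_(i <- r | P i) F i) e = \sum_(i <- r | P i) F i e.
Proof. by elim/big_rec2: _ => // i x y _ <-. Qed.

End PowerSeries.

(** * Logarithms of power series *)

Section Logarithm.
Variable K : fieldType.
Hypothesis natr_neq0 : forall n, n.+1%:R != 0 :> K.

Implicit Types f g h u v L : pseries K.

Lemma natr_gt0_neq0 n : (0 < n)%N -> n%:R != 0 :> K.
Proof. by case: n => // n _; apply: natr_neq0. Qed.

Definition euler (f : pseries K) : pseries K := fun e => (mdeg e)%:R * f e.

(** Logarithmic differentiation: in characteristic 0 this determines [L] from [f].
    That logarithms turn products into sums is then the Leibniz rule. *)
Definition is_log (f L : pseries K) : Prop :=
  [/\ f mset0 = 1, L mset0 = 0 & euler f = f * euler L].

Lemma eulerM (f g : pseries K) : euler (f * g) = euler f * g + f * euler g.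
Proof.
apply/funext => e; rewrite cfD /euler !cfM mulr_sumr -big_split.
apply: eq_big_seq => d; rewrite mem_msub => /mdegB -> /=.
by rewrite natrD; ring.
Qed.

Lemma eulerD (f g : pseries K) : euler (f + g) = euler f + euler g.
Proof. by apply/funext => e; rewrite /euler !cfD mulrDr. Qed.

Lemma eulerN (f : pseries K) : euler (- f) = - euler f.
Proof. by apply/funext => e; rewrite /euler !cfN mulrN. Qed.

Lemma euler1 : euler 1 = 0.
Proof.
apply/funext => e; rewrite /euler /GRing.one /= /p1; case: eqVneq => [->|]; last by rewrite mulr0.
by rewrite mdeg0 mul0r.
Qed.

Lemma eulerX (u : pseries K) n : euler (u ^+ n.+1) = n.+1%:R * u ^+ n * euler u.
Proof.
elim: n => [|n IH]; first by rewrite expr1 expr0; ring.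
by rewrite exprS eulerM IH [in RHS]mulrSr exprS; ring.
Qed.

Lemma cfM0 (f g : pseries K) : (f * g) mset0 = f mset0 * g mset0.
Proof.
rewrite cfM (bigD1_seq mset0) ?msub_uniq ?mem_msub ?msub0set //=.
rewrite msetBxx big_seq_cond big1 ?addr0 // => d /andP[].
by rewrite mem_msub msubset0 => ->.
Qed.

Lemma mulr_const1_eq0 (f g : pseries K) : f mset0 = 1 -> f * g = 0 -> g = 0.
Proof.
move=> f1 fg; apply/funext => e; elim: {e}(mdeg e).+1 {-2}e (ltnSn (mdeg e)) => // n IH e en.
have := congr1 (@^~ e) fg; rewrite cfM (bigD1_seq mset0) ?msub_uniq ?mem_msub ?msub0set //=.
rewrite msetB0 f1 mul1r big_seq_cond big1 ?addr0 // => d /andP[].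
rewrite mem_msub => de; rewrite -mdeg_eq0 => d0; rewrite IH ?mulr0 //.
by have := mdegB de; lia.
Qed.

Lemma is_log1 : is_log 1 0.
Proof.
split=> //; first by rewrite /GRing.one /= /p1 eqxx.
by rewrite euler1 (_ : euler 0 = 0) ?mulr0 //; apply/funext => e; rewrite /euler cf0 mulr0.
Qed.

Lemma is_logM f g L M : is_log f L -> is_log g M -> is_log (f * g) (L + M).
Proof.
move=> [f1 L0 fL] [g1 M0 gM]; split; first by rewrite cfM0 f1 g1 mulr1.
  by rewrite cfD L0 M0 addr0.
by rewrite eulerM fL gM eulerD; ring.
Qed.

Lemma is_log_prod I (r : seq I) (P : pred I) (f L : I -> pseries K) :
  (forall i, P i -> is_log (f i) (L i)) ->
  is_log (\prod_(i <- r | P i) f i) (\sum_(i <- r | P i) L i).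
Proof.
move=> H; elim/big_ind2: _ => //; first exact: is_log1.
by move=> *; apply: is_logM.
Qed.

Lemma euler_inj (L M : pseries K) : L mset0 = M mset0 -> euler L = euler M -> L = M.
Proof.
move=> LM0 E; apply/funext => e; case: (eqVneq e mset0) => [->//|e0].
have := congr1 (@^~ e) E; rewrite /euler => /mulfI; apply.
by apply: natr_gt0_neq0; rewrite lt0n mdeg_eq0.
Qed.

Lemma is_log_uniq f L M : is_log f L -> is_log f M -> L = M.
Proof.
move=> [f1 L0 fL] [_ M0 fM]; apply: euler_inj; first by rewrite L0 M0.
by apply/eqP; rewrite -subr_eq0; apply/eqP/(mulr_const1_eq0 f1); rewrite mulrBr -fL -fM subrr.
Qed.

Lemma is_logV f g L : is_log f L -> g * f = 1 -> is_log g (- L).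
Proof.
move=> [f1 L0 fL] gf.
have g1 : g mset0 = 1.
  by have := congr1 (@^~ mset0) gf; rewrite cfM0 f1 mulr1 => ->; rewrite /GRing.one /= /p1 eqxx.
split=> //; first by rewrite cfN L0 oppr0.
have E : euler g * f + g * euler f = 0 by rewrite -eulerM gf euler1.
apply/eqP; rewrite -subr_eq0 eulerN mulrN opprK; apply/eqP.
rewrite -[LHS]mul1r -gf; move: E; rewrite fL => /(congr1 (fun x => g * x)).
by rewrite mulr0 => <-; ring.
Qed.

(** If [u(0) = 0], then [u^n] has no monomial of degree less than [n]; this is why the
    power series below may be truncated at any bound that is at least the degree of
    the monomial. *)
Definition pexpn (f : pseries K) (n : nat) : pseries K := iter n (@pmul K f) (@p1 K).
Definition psub (f g : pseries K) : pseries K := fun e => f e - g e.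
Definition pscale (c : K) (f : pseries K) : pseries K := fun e => c * f e.
Definition pinv (f : pseries K) : pseries K :=
  fun e => \sum_(n < (mdeg e).+1) pexpn (psub (@p1 K) f) n e.
Definition plog (f : pseries K) : pseries K :=
  fun e => \sum_(1 <= n < (mdeg e).+1) (-1) ^+ n.-1 / n%:R * pexpn (psub f (@p1 K)) n e.
Definition pexp (f : pseries K) : pseries K :=
  fun e => \sum_(n < (mdeg e).+1) (n`!%:R)^-1 * pexpn f n e.
Definition pquot (f g : pseries K) : pseries K := pmul f (pinv g).
Definition ppow (f : pseries K) (r : rat) : pseries K := pexp (pscale (ratr r) (plog f)).

Lemma pexpnE (f : pseries K) n : pexpn f n = f ^+ n.
Proof. by elim: n => // n IH; rewrite exprS -IH. Qed.

Lemma exprs_gt_mdeg (u : pseries K) n e : u mset0 = 0 -> (mdeg e < n)%N -> (u ^+ n) e = 0.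
Proof.
move=> u0; elim: n e => // n IH e en; rewrite exprS cfM big_seq big1 // => d.
rewrite mem_msub => de; have [->|d0] := eqVneq d mset0; first by rewrite u0 mul0r.
rewrite IH ?mulr0 //; have := mdegB de; move: d0; rewrite -mdeg_eq0; lia.
Qed.

Lemma mulsr_exprs_gt_mdeg (u v : pseries K) n e :
  u mset0 = 0 -> (mdeg e < n)%N -> (v * u ^+ n) e = 0.
Proof.
move=> u0 en; rewrite cfM big_seq big1 // => d; rewrite mem_msub => de.
by rewrite exprs_gt_mdeg ?mulr0 //; have := mdegB de; lia.
Qed.

Lemma eq_cfM (f f' g g' : pseries K) e :
  (forall d, (d `<=` e)%mset -> f d = f' d) -> (forall d, (d `<=` e)%mset -> g d = g' d) ->
  (f * g) e = (f' * g') e.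
Proof.
move=> H H'; rewrite !cfM; apply: eq_big_seq => d; rewrite mem_msub => de.
by rewrite H // H' // msubsetDl.
Qed.

Lemma mdeg_sub (d e : monomial) : (d `<=` e)%mset -> (mdeg d <= mdeg e)%N.
Proof. by move=> /mdegB ->; rewrite leq_addr. Qed.

Lemma pinvE f M e : f mset0 = 1 -> (mdeg e <= M)%N ->
  pinv f e = (\sum_(n < M.+1) (1 - f) ^+ n) e.
Proof.
move=> f1 eM; rewrite cf_sum /pinv -(subnKC eM) -addSn big_split_ord /= [X in _ = _ + X]big1; last first.
  move=> i _; rewrite exprs_gt_mdeg //; last by rewrite addSn ltnS leq_addr.
  by rewrite cfD cfN f1 /GRing.one /= /p1 eqxx subrr.
by rewrite addr0; apply: eq_bigr => i _; rewrite pexpnE.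
Qed.

Lemma mulVs f : f mset0 = 1 -> (pinv f : pseries K) * f = 1.
Proof.
move=> f1; apply/funext => e; rewrite (@eq_cfM _ (\sum_(n < (mdeg e).+1) (1 - f) ^+ n) _ f) //; last first.
  by move=> d /mdeg_sub de; apply: pinvE.
set u := 1 - f; have -> : f = 1 - u by rewrite /u opprB addrC subrK.
have /(congr1 (fun x : pseries K => - x)) := subrX1 u (mdeg e).+1.
rewrite -mulNr !opprB mulrC => <-; rewrite cfD cfN. rewrite exprs_gt_mdeg ?subr0 //.
by rewrite /u cfD cfN f1 /GRing.one /= /p1 eqxx subrr.
Qed.

Lemma is_log_pinv f L : is_log f L -> is_log (pinv f) (- L).
Proof. by move=> fL; have [f1 _ _] := fL; apply: is_logV fL _; rewrite mulVs. Qed.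

Lemma is_log_pquot f g L M : is_log f L -> is_log g M -> is_log (pquot f g) (L - M).
Proof. by move=> fL gM; apply: is_logM fL (is_log_pinv gM). Qed.

Lemma plogE f M e : f mset0 = 1 -> (mdeg e <= M)%N ->
  plog f e = \sum_(n < M) (-1) ^+ n / n.+1%:R * ((f - 1) ^+ n.+1) e.
Proof.
move=> f1 eM; rewrite /plog big_add1 big_mkord -(subnKC eM) big_split_ord /= [X in _ = _ + X]big1.
  by rewrite addr0; apply: eq_bigr => i _; rewrite exprS -pexpnE.
move=> i _; rewrite exprs_gt_mdeg ?mulr0 //; last by rewrite ltnS leq_addr.
by rewrite cfD cfN f1 /GRing.one /= /p1 eqxx subrr.
Qed.

Lemma pexpE f M e : f mset0 = 0 -> (mdeg e <= M)%N ->
  pexp f e = \sum_(n < M.+1) (n`!%:R)^-1 * (f ^+ n) e.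
Proof.
move=> f0 eM; rewrite /pexp -(subnKC eM) -addSn big_split_ord /= [X in _ = _ + X]big1.
  by rewrite addr0; apply: eq_bigr => i _; rewrite pexpnE.
by move=> i _; rewrite exprs_gt_mdeg ?mulr0 //; rewrite addSn ltnS leq_addr.
Qed.

Lemma cf_natrM n f e : (n%:R * f : pseries K) e = n%:R * f e.
Proof.
by elim: n => [|n IH]; rewrite ?mul0r // -addn1 !natrD !mulrDl !mul1r cfD IH.
Qed.

Lemma cf_signM n f e : ((-1) ^+ n * f : pseries K) e = (-1) ^+ n * f e.
Proof.
elim: n => [|n IH]; first by rewrite !expr0 !mul1r.
by rewrite !exprS !mulN1r !mulNr cfN IH.
Qed.

(** [D] applied to the truncated logarithm of [1 + u] is a truncated geometric
    series in [- u] times [D u]. *)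
Lemma is_log_plog f : f mset0 = 1 -> is_log f (plog f).
Proof.
move=> f1; split=> //; first by rewrite /plog mdeg0 big_geq.
set u := f - 1.
have fu : f = 1 + u by rewrite /u addrC subrK.
have u0 : u mset0 = 0 by rewrite /u cfD cfN f1 /GRing.one /= /p1 eqxx subrr.
apply/funext => e; set M := (mdeg e).+1.
rewrite (@eq_cfM f f _ ((\sum_(n < M) (- u) ^+ n) * euler u)) //; last first.
  move=> d /mdeg_sub/leqW dM; rewrite /euler (plogE f1 dM) mulr_suml cf_sum mulr_sumr.
  apply: eq_bigr => n _.
  have E : (mdeg d)%:R * (u ^+ n.+1) d = (n.+1%:R * u ^+ n * euler u) d by rewrite -eulerX.
  rewrite mulrCA E -mulrA cf_natrM -[_ / _ * _]mulrA mulKf ?natr_neq0 //.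
  by rewrite [(- u) ^+ n]exprNn -mulrA cf_signM.
have E : f * \sum_(n < M) (- u) ^+ n = 1 - (- u) ^+ M.
  by clearbody u; rewrite -[RHS]opprB subrX1 -mulNr opprB opprK -fu.
rewrite mulrA E mulrBl mul1r cfD cfN {1}fu eulerD euler1 add0r mulrC.
by rewrite mulsr_exprs_gt_mdeg ?subr0 //; rewrite cfN u0 oppr0.
Qed.

Lemma is_log_pexp L : L mset0 = 0 -> is_log (pexp L) L.
Proof.
move=> L0; split=> //.
  by rewrite /pexp mdeg0 big_ord_recl big_ord0 fact0 invr1 mul1r addr0 /pexpn /= /p1 eqxx.
apply/funext => e; set M := mdeg e.
rewrite (@eq_cfM (pexp L) (\sum_(n < M.+1) pscale (n`!%:R)^-1 (L ^+ n)) _ (euler L)) //; last first.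
  by move=> d /mdeg_sub dM; rewrite (pexpE L0 dM) cf_sum.
rewrite /euler (@pexpE L M.+1) // big_ord_recl mulrDr mulr_suml cf_sum.
have -> : (mdeg e)%:R * (((ord0 : 'I_M.+2)`!%:R)^-1 * (L ^+ (ord0 : 'I_M.+2)) e) = 0 :> K.
  rewrite expr0 /GRing.one /= /p1 -mdeg_eq0; case: eqVneq => [->|_]; first by rewrite mul0r.
  by rewrite !mulr0.
rewrite add0r mulr_sumr; apply: eq_bigr => n _.
have E : (mdeg e)%:R * (L ^+ n.+1) e = (n.+1%:R * L ^+ n * euler L) e by rewrite -eulerX.
rewrite mulrCA lift0 E -mulrA cf_natrM factS natrM invfM. rewrite mulrACA mulVf ?natr_neq0 // mul1r.
rewrite !cfM mulr_sumr; apply: eq_bigr => d _. exact: mulrA.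
Qed.

Lemma is_log_ppow f L r : is_log f L -> is_log (ppow f r) (pscale (ratr r) L).
Proof.
move=> fL; have [f1 _ _] := fL; rewrite /ppow (is_log_uniq (is_log_plog f1) fL).
have [_ L0 _] := fL; by apply: is_log_pexp; rewrite /pscale L0 mulr0.
Qed.

End Logarithm.

(** * Convergence of infinite products *)

Section Convergence.
Variable K : fieldType.
Hypothesis natr_neq0 : forall n, n.+1%:R != 0 :> K.

(** The neighbourhoods of 0 in a topological field given by a valuation; the
    relevant example is the order of the expansion in [1/q]. *)
Record filtration (small : nat -> K -> Prop) : Prop := Filtration {
  filtration0 : forall B, small B 0;
  filtrationB : forall B x y, small B x -> small B y -> small B (x - y);
  filtration_le : forall B C x, (B <= C)%N -> small C x -> small B x;
  filtrationM : forall B C x y, small B x -> small C y -> small (B + C) (x * y);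
  filtration_scale : forall c, exists C, forall B x, small (B + C) x -> small B (c * x);
  filtration_eq0 : forall x, (forall B, small B x) -> x = 0 }.

Variable small : nat -> K -> Prop.
Hypothesis fil : filtration small.

Lemma small0 B : small B 0.
Proof. exact: filtration0 fil B. Qed.
#[local] Hint Resolve small0 : core.

Lemma smallB B x y : small B x -> small B y -> small B (x - y).
Proof. exact: filtrationB fil B x y. Qed.

Lemma small_le B C x : (B <= C)%N -> small C x -> small B x.
Proof. exact: filtration_le fil B C x. Qed.

Lemma smallM B C x y : small B x -> small C y -> small (B + C) (x * y).
Proof. exact: filtrationM fil B C x y. Qed.

Lemma small_scale c : exists C, forall B x, small (B + C) x -> small B (c * x).
Proof. exact: filtration_scale fil c. Qed.

Lemma small_eq0 x : (forall B, small B x) -> x = 0.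
Proof. exact: filtration_eq0 fil x. Qed.

Lemma smallN B x : small B x -> small B (- x).
Proof. by move=> Bx; rewrite -sub0r; apply: smallB. Qed.

Lemma smallD B x y : small B x -> small B y -> small B (x + y).
Proof. by move=> Bx By; rewrite -[y]opprK; apply/smallB/smallN. Qed.

Lemma small_sum I (r : seq I) (P : pred I) (F : I -> K) B :
  (forall i, P i -> small B (F i)) -> small B (\sum_(i <- r | P i) F i).
Proof. by move=> H; elim/big_ind: _ => // x y; apply: smallD. Qed.

Section Nets.
Variables (I : choiceType) (D : set I).
Implicit Types (S : {fset I}) (u v : {fset I} -> K) (P Q : {fset I} -> Prop).

(** Convergence along the net of the finite subsets of [D]. *)
Definition eventually P : Prop :=
  exists S0, [set` S0] `<=` D /\
  forall S, [set` S0] `<=` [set` S] -> [set` S] `<=` D -> P S.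

Lemma eventually_all P : (forall S, [set` S] `<=` D -> P S) -> eventually P.
Proof. by move=> H; exists fset0; split=> [x|S _]; [|apply: H]. Qed.

Lemma eventually_and P Q R : (forall S, [set` S] `<=` D -> P S -> Q S -> R S) ->
  eventually P -> eventually Q -> eventually R.
Proof.
move=> H [S [SD PS]] [T [TD QT]]; exists (S `|` T)%fset; split=> [x /=|U U1 UD].
  by rewrite inE => /orP[/SD|/TD].
by apply: H => //; [apply: PS|apply: QT] => // x xS; apply: U1; rewrite /= inE; apply/orP; [left|right].
Qed.

Definition tends u (l : K) : Prop := forall B, eventually (fun S => small B (u S - l)).

Lemma tends_cst l : tends (fun=> l) l.
Proof. by move=> B; apply: eventually_all => S _; rewrite subrr. Qed.

Lemma eq_tends u v l : (forall S, [set` S] `<=` D -> u S = v S) -> tends u l -> tends v l.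
Proof.
move=> uv ul B; apply: eventually_and (ul B) (ul B) => S SD; by rewrite uv.
Qed.

Lemma tendsD u v l m : tends u l -> tends v m -> tends (fun S => u S + v S) (l + m).
Proof.
move=> ul vm B; apply: eventually_and (ul B) (vm B) => S _ us vs.
by rewrite opprD addrACA; apply: smallD.
Qed.

Lemma tendsM u v l m : tends u l -> tends v m -> tends (fun S => u S * v S) (l * m).
Proof.
move=> ul vm B; have [Cl Hl] := small_scale l; have [Cm Hm] := small_scale m.
apply: eventually_and (ul (B + Cm)%N) (vm (B + Cl)%N) => S _ us vs.
have -> : u S * v S - l * m = (u S - l) * (v S - m) + m * (u S - l) + l * (v S - m) by ring.
apply/smallD/Hl => //; apply/smallD/Hm => //.
by rewrite -[B]addn0; apply: smallM; [apply: small_le us|apply: small_le vs]; rewrite ?leq_addr.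
Qed.

Lemma tends_sum J (r : seq J) (P : pred J) (u : J -> {fset I} -> K) (l : J -> K) :
  (forall j, P j -> tends (u j) (l j)) ->
  tends (fun S => \sum_(j <- r | P j) u j S) (\sum_(j <- r | P j) l j).
Proof.
move=> H; elim: r => [|j r IH].
  by rewrite big_nil; apply: eq_tends (tends_cst 0) => S _; rewrite big_nil.
rewrite big_cons; case: ifP => Pj; last by apply: eq_tends IH => S _; rewrite big_cons Pj.
by apply: eq_tends (tendsD (H _ Pj) IH) => S _; rewrite big_cons Pj.
Qed.

Lemma tends_uniq u l m : tends u l -> tends u m -> l = m.
Proof.
move=> ul um; apply/eqP; rewrite -subr_eq0; apply/eqP/small_eq0 => B.
have [S [SD H]] := ul B; have [T [TD H']] := um B.
have -> : l - m = (u (S `|` T)%fset - m) - (u (S `|` T)%fset - l) by ring.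
have UD : [set` (S `|` T)%fset] `<=` D by move=> x /=; rewrite inE => /orP[/SD|/TD].
by apply: smallB; [apply: H' | apply: H] => // x xS; rewrite /= inE; apply/orP; [right|left].
Qed.

(** Comparison of the coefficients in [D f = f D L]; the term with [d = e] drops
    out since [L] has no constant term. *)
Lemma cf_is_log (f L : pseries K) e : is_log f L -> e != mset0 ->
  f e = (mdeg e)%:R^-1 * \sum_(d <- msub e | d != e) f d * euler L (e `\` d)%mset.
Proof.
move=> [_ L0 fL] e0; have M0 : (mdeg e)%:R != 0 :> K.
  by apply: natr_gt0_neq0; rewrite // lt0n mdeg_eq0.
apply: (mulfI M0); rewrite mulVKf // -[LHS]/(euler f e) fL cfM.
rewrite (bigD1_seq e) ?msub_uniq ?mem_msub ?msubset_refl //=.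
by rewrite msetBxx /euler L0 !mulr0 add0r.
Qed.

(** The exponential is continuous: coefficient by coefficient it is a polynomial
    in lower coefficients of the logarithm and of itself. *)
Lemma is_log_tends (f L : {fset I} -> pseries K) (F M : pseries K) :
  (forall S, [set` S] `<=` D -> is_log (f S) (L S)) -> is_log F M ->
  (forall e, tends (fun S => L S e) (M e)) -> forall e, tends (fun S => f S e) (F e).
Proof.
move=> fL FM LM e; elim: {e}(mdeg e).+1 {-2}e (ltnSn (mdeg e)) => // n IH e en.
have [->|e0] := eqVneq e mset0.
  have [-> _ _] := FM; apply: eq_tends (tends_cst 1) => S SD.
  by have [-> _ _] := fL S SD.
rewrite (cf_is_log FM e0).
apply: eq_tends => [S SD|]; first by rewrite (cf_is_log (fL S SD) e0).
apply/tendsM; first exact: tends_cst.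
rewrite [X in tends _ X]big_seq_cond; apply: eq_tends => [S SD|]; first by rewrite [in RHS]big_seq_cond.
apply: tends_sum => d; rewrite mem_msub => /andP[de nde]; apply: tendsM; last first.
  by apply: tendsM; [apply: tends_cst | apply: LM].
apply: IH; have := mdegB de; suff : mdeg (e `\` d)%mset != 0%N by lia.
rewrite mdeg_eq0; apply: contraNneq nde => E.
by rewrite -[e](msetBDKC de) E msetD0.
Qed.

Definition has_pprod (f : I -> pseries K) (F : pseries K) : Prop :=
  forall e B, eventually (fun S => small B ((\big[@pmul K/@p1 K]_(i <- S) f i) e - F e)).

Lemma has_pprod_uniq f F G : has_pprod f F -> has_pprod f G -> F = G.
Proof.
move=> fF fG; apply/funext => e.
by apply: (@tends_uniq (fun S => (\big[@pmul K/@p1 K]_(i <- S) f i) e)) => B.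
Qed.

Lemma has_pprod_is_log (f L : I -> pseries K) (F M : pseries K) :
  (forall i, D i -> is_log (f i) (L i)) -> is_log F M ->
  (forall e, tends (fun S => \sum_(i <- S) L i e) (M e)) -> has_pprod f F.
Proof.
move=> fL FM LM e; apply: (@is_log_tends (fun S => \prod_(i <- S) f i)
  (fun S => \sum_(i <- S) L i) F M) => // [S SD|d].
  rewrite big_seq [X in is_log _ X]big_seq; apply: is_log_prod => i iS.
  exact/fL/SD.
by apply: eq_tends (LM d) => S _; rewrite cf_sum.
Qed.

End Nets.

Section WeightedGeometric.
Hypothesis small_nat : forall n, small 0 n%:R.

Variable y : K.
Hypothesis small_y : forall n, small n (y ^+ n).
Hypothesis y_neq1 : y != 1.

(** The remainder has a factor [y^(M+1)]. *)
Lemma weighted_geometric M :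
  (\sum_(m <- iota 1 M) m%:R * y ^+ m) * (1 - y) ^+ 2
  = y - y ^+ M.+1 * (M.+1%:R - M%:R * y).
Proof.
elim: M => [|M IH]; first by rewrite big_nil mul0r expr1 mul0r subr0 mulr1 subrr.
have -> : iota 1 M.+1 = iota 1 M ++ [:: M.+1] by rewrite -[M.+1 in LHS]addn1 iotaD add1n.
rewrite big_cat big_seq1 /= mulrDl IH [y ^+ M.+2]exprS.
by rewrite -[M.+2]addn2 -[M.+1]addn1 !natrD; ring.
Qed.

Variables (J : choiceType) (ok : J -> Prop) (tau : J).
Hypothesis ok_tau : ok tau.

Lemma tends_weighted_geometric :
  tends [set x : J * nat | ok x.1 /\ (1 <= x.2)%N]
    (fun S => \sum_(x <- S | x.1 == tau) x.2%:R * y ^+ x.2) (y / (1 - y) ^+ 2).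
Proof.
move=> B; have [C HC] := small_scale ((1 - y) ^- 2); set M := (B + C)%N.
have y1 : (1 - y) ^+ 2 != 0 by rewrite expf_neq0 // subr_eq0 eq_sym.
(* [C] is lost on the factor [(1 - y)^-2] of the remainder. *)
exists [fset x in [seq (tau, m) | m <- iota 1 M]]%fset; split=> [x|S S1 S2].
  by rewrite /= inE => /mapP[m]; rewrite mem_iota => /andP[m1 _] ->.
rewrite (bigID (fun x => x.2 <= M)%N) /=.
have -> : \sum_(x <- S | (x.1 == tau) && (x.2 <= M)%N) x.2%:R * y ^+ x.2
    = \sum_(m <- iota 1 M) m%:R * y ^+ m.
  rewrite -big_filter -(big_map (pair tau) xpredT (fun x => x.2%:R * y ^+ x.2)).
  apply: perm_big; apply: uniq_perm.
  - by rewrite filter_uniq ?fset_uniq.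
  - by rewrite map_inj_uniq ?iota_uniq // => m n [].
  move=> [j m]; rewrite mem_filter /=; apply/andP/mapP => [[/andP[/eqP -> mM]] jS|[n]].
    by exists m => //; rewrite mem_iota add1n ltnS mM andbT; have [_] := S2 _ jS.
  rewrite mem_iota add1n ltnS => /andP[n1 nM] [-> ->]; rewrite eqxx nM; split=> //.
  by apply: S1; rewrite /= inE; apply: map_f; rewrite mem_iota n1 add1n ltnS.
set T := \sum_(x <- S | _) _; set G := \sum_(m <- _) _.
have E : G - y / (1 - y) ^+ 2 = - ((1 - y) ^- 2 * (y ^+ M.+1 * (M.+1%:R - M%:R * y))).
  apply: (mulIf y1); rewrite mulrBl divfK // weighted_geometric mulNr.
  by rewrite [(1 - y) ^- 2 * _]mulrC divfK //; ring.
rewrite addrAC E [_ + T]addrC. apply: smallB; last first.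
  apply: HC; rewrite -/M; apply: (@small_le _ (M.+1 + 0)); first by rewrite addn0.
  apply: (smallM (small_y _)); apply: (smallB (small_nat _)).
  rewrite -[0%N]addn0; apply: (smallM (small_nat _)).
  by apply: (small_le (leq0n 1)); rewrite -[y]expr1.
apply: small_sum => // x; rewrite -ltnNge => /andP[_ Mx].
rewrite -[B]add0n; apply: (smallM (small_nat _)); apply: small_le (small_y x.2).
by apply: leq_trans (ltnW Mx); apply: leq_addr.
Qed.

End WeightedGeometric.

End Convergence.

(** * Products of power sums *)

Fixpoint words (T : Type) (r : seq T) (l : nat) : seq (seq T) :=
  if l is l'.+1 then [seq i :: w | i <- r, w <- words r l'] else [:: [::]].

Lemma mem_words (T : eqType) (r : seq T) l w :
  (w \in words r l) = (size w == l) && all (mem r) w.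
Proof.
elim: l w => [|l IH] w /=; first by rewrite inE; case: w.
apply/allpairsP/idP => [[[i v] /= [ir vl ->]]|].
  by move: vl; rewrite IH /= eqSS => /andP[-> ->]; rewrite ir.
by case: w => //= i v /andP[sv /andP[ir vr]]; exists (i, v); rewrite /= IH -eqSS sv vr.
Qed.

Lemma words_uniq (T : eqType) (r : seq T) l : uniq r -> uniq (words r l).
Proof.
move=> ur; elim: l => //= l IH; apply: allpairs_uniq => //.
by move=> [i v] [j w] _ _ /= [-> ->].
Qed.

Lemma zmon_cons n mu i w : zmon (n :: mu) (i :: w) = (zvar_pow n i `+` zmon mu w)%mset.
Proof.
apply/msetP => x; rewrite msetE2 /zmon !mset_seqE /= count_cat; congr (_ + _)%N.
rewrite /zvar_pow msetnE [x == i]eq_sym; elim: n => [|n /= ->]; first by rewrite if_same.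
by case: eqP.
Qed.

Lemma zmon_nil w : zmon [::] w = mset0.
Proof. by apply/msetP => x; rewrite /zmon mset_seqE mset0E; case: w. Qed.

Lemma mdeg_zmon mu w : size w = size mu -> mdeg (zmon mu w) = sumn mu.
Proof.
elim: mu w => [|n mu IH] [|i w] //=; first by rewrite zmon_nil mdeg0.
by move=> [sw]; rewrite zmon_cons mdegD IH // /mdeg /zvar_pow enum_msetn size_nseq.
Qed.

Lemma zmon_supp mu w x : 0%N \notin mu -> size w = size mu -> (x \in zmon mu w) = (x \in w).
Proof.
elim: mu w => [|n mu IH] [|i w] //=; first by rewrite zmon_nil in_mset0.
rewrite inE negb_or eq_sym -lt0n => /andP[n0 mu0] [sw].
by rewrite zmon_cons in_msetD IH // in_msetn n0 inE.
Qed.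

(** With distinct variables the exponents are the parts. *)
Lemma map_zmon mu w : uniq w -> size w = size mu -> [seq zmon mu w x | x <- w] = mu.
Proof.
elim: mu w => [|n mu IH] [|i w] //= /andP[iw uw] [sw]; rewrite zmon_cons.
have zi : zmon mu w i = 0%N.
  elim: mu w sw iw {IH uw} => [|m mu IH] [|j w] //=; first by rewrite zmon_nil mset0E.
  move=> [sw]; rewrite inE negb_or => /andP[ij iw].
  by rewrite zmon_cons msetE2 msetnE (negPf ij) IH.
rewrite msetE2 msetnxx zi addn0; congr cons.
rewrite -[RHS](IH _ uw sw); apply/eq_in_map => x xw; rewrite msetE2 msetnE.
by case: eqP => [xi|//]; rewrite -xi xw in iw.
Qed.

Section Monomials.
Variable K : fieldType.

Definition mono (m : monomial) : pseries K := fun e => (e == m)%:R.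

Lemma mono0 : mono mset0 = 1. Proof. by []. Qed.

Lemma monoM m m' : mono m * mono m' = mono (m `+` m')%mset.
Proof.
apply/funext => e; rewrite cfM /mono; have [->|ne] := eqVneq e (m `+` m')%mset.
  rewrite (bigD1_seq m) ?msub_uniq ?mem_msub //=; last by rewrite -{1}[m]msetD0 msetDS // msub0set.
  rewrite msetDC msetDKBC !eqxx mulr1 big1 ?addr0 // => d /negPf ->.
  by rewrite mul0r.
rewrite big_seq big1 // => d; rewrite mem_msub => de.
case: eqVneq => [dm|_]; last by rewrite mul0r.
case: eqVneq => [em|_]; last by rewrite mulr0.
by case/eqP: ne; rewrite -dm -em msetBDKC.
Qed.

Definition ppow_sum (n : nat) : pseries K :=
  fun e => \sum_(i \in [set: int]) ((e == zvar_pow n i)%:R : K).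

Definition ppbprod (p : nat -> pseries K) (mu : seq nat) : pseries K :=
  \big[@pmul K/@p1 K]_(i <- mu) p i.

Lemma ppow_sumE n e (r : seq int) : (0 < n)%N -> uniq r -> {subset e <= r} ->
  ppow_sum n e = (\sum_(i <- r) mono (zvar_pow n i)) e.
Proof.
move=> n0 ur er; rewrite /ppow_sum cf_sum (fsbigE r) //.
- by apply: eq_bigl => i; rewrite in_setT.
- move=> i _ ir; case: eqVneq => // ez; case/negP: ir; apply: er.
  by rewrite ez in_msetn n0 eqxx.
Qed.

Lemma prod_sum_mono mu (r : seq int) :
  \prod_(n <- mu) (\sum_(i <- r) mono (zvar_pow n i)) =
  \sum_(w <- words r (size mu)) mono (zmon mu w).
Proof.
elim: mu => [|n mu IH]; first by rewrite big_nil /= big_seq1 zmon_nil.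
rewrite big_cons IH /= big_allpairs_dep /= mulr_suml; apply: eq_bigr => i _.
by rewrite mulr_sumr; apply: eq_bigr => w _; rewrite monoM zmon_cons.
Qed.

(** The coefficient of a product of power sums counts the choices of one
    variable for each part. *)
Lemma ppbprodE mu e (r : seq int) : 0%N \notin mu -> uniq r -> {subset e <= r} ->
  ppbprod ppow_sum mu e = (count (fun w => e == zmon mu w) (words r (size mu)))%:R.
Proof.
move=> mu0 ur er; transitivity ((\prod_(n <- mu) (\sum_(i <- r) mono (zvar_pow n i))) e).
  elim: mu mu0 e er => [|n mu IH] mu0 e er; first by rewrite /ppbprod !big_nil.
  move: mu0; rewrite inE negb_or eq_sym -lt0n => /andP[n0 mu0].
  rewrite /ppbprod !big_cons; apply: eq_cfM => d de.
    by apply: ppow_sumE => // x xd; apply/er/(msubset_subset de).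
  by apply: IH => // x xd; apply/er/(msubset_subset de).
rewrite prod_sum_mono cf_sum -sum1_count natr_sum [RHS]big_mkcond.
by apply: eq_bigr => w _; rewrite /mono; case: eqP.
Qed.

Lemma ppbprod_neq0 mu e : 0%N \notin mu -> ppbprod ppow_sum mu e != 0 ->
  exists w, size w = size mu /\ e = zmon mu w.
Proof.
move=> mu0; rewrite (@ppbprodE _ _ (undup (enum_mset e))) ?undup_uniq //;
  last by move=> x; rewrite mem_undup.
case E : (count _ _) => [|k]; first by rewrite eqxx.
have : has (fun w => e == zmon mu w) (words (undup (enum_mset e)) (size mu)) by rewrite has_count E.
by case/hasP => w; rewrite mem_words => /andP[/eqP sw _] /eqP ->; exists w.
Qed.

(** Homogeneity is what makes the sums over partitions finite at each monomial;
    it holds at [z] and at [w]. *)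
Definition graded (p : nat -> pseries K) :=
  forall n d, (0 < n)%N -> p n d != 0 -> mdeg d = n.

Lemma graded_ppow_sum : graded ppow_sum.
Proof.
move=> n d n0; rewrite (@ppow_sumE _ _ (undup (enum_mset d))) ?undup_uniq //;
  last by move=> x; rewrite mem_undup.
rewrite cf_sum; have [/hasP [i _ /eqP ->] _|/hasPn H] := boolP (has (fun i => d == zvar_pow n i) (undup (enum_mset d))).
  by rewrite /mdeg /zvar_pow enum_msetn size_nseq.
by rewrite big_seq big1 ?eqxx // => i /H; rewrite /mono => /negPf ->.
Qed.

Lemma graded_ppbprod p mu d : graded p -> 0%N \notin mu -> ppbprod p mu d != 0 -> mdeg d = sumn mu.
Proof.
move=> gp; elim: mu d => [|n mu IH] d.
  move=> _; rewrite /ppbprod big_nil /p1; have [->|_] := eqVneq d mset0.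
    by rewrite mdeg0.
  by rewrite eqxx.
rewrite inE negb_or eq_sym -lt0n => /andP[n0 mu0].
rewrite /ppbprod big_cons => H; have [/hasP [c]|/hasPn H'] :=
  boolP (has (fun c => (p n c != 0) && (ppbprod p mu (d `\` c)%mset != 0)) (msub d)).
  rewrite mem_msub => cd /andP[/gp cn /IH dn]; by rewrite (mdegB cd) cn // dn.
case/eqP: H; rewrite -[LHS]/((p n * ppbprod p mu) d) cfM big_seq big1 // => c /H'.
by rewrite negb_and !negbK => /orP[] /eqP ->; rewrite ?mul0r ?mulr0.
Qed.

Lemma ppbprod_cat p mu nu : ppbprod p (mu ++ nu) = ppbprod p mu * ppbprod p nu.
Proof. exact: (@big_cat _ _ (@GRing.mul (pseries K))). Qed.

Lemma perm_ppbprod p mu nu : perm_eq mu nu -> ppbprod p mu = ppbprod p nu.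
Proof.
move=> E; change (\prod_(n <- mu) p n = \prod_(n <- nu) p n); exact: perm_big.
Qed.

End Monomials.

Lemma geq_trans : transitive geq.
Proof. by move=> y x z; rewrite /geq /= => yx zy; apply: leq_trans yx. Qed.

Lemma geq_anti : antisymmetric geq.
Proof. by move=> x y; rewrite /geq /= andbC => /anti_leq. Qed.

Lemma geq_total : total geq.
Proof. by move=> x y; exact: leq_total. Qed.

Definition join_parts (mu nu : seq nat) := sort geq (mu ++ nu).

Lemma perm_join_parts mu nu : perm_eq (join_parts mu nu) (mu ++ nu).
Proof. by rewrite perm_sort. Qed.

Lemma partition_notin0 mu : is_partition mu -> 0%N \notin mu.
Proof. by case/andP. Qed.

Lemma join_parts_partition mu nu :
  is_partition mu -> is_partition nu -> is_partition (join_parts mu nu).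
Proof.
move=> /andP[_ mu0] /andP[_ nu0]; apply/andP; split; first exact: (sort_sorted geq_total).
by rewrite mem_sort mem_cat negb_or mu0.
Qed.

Lemma sumn_join_parts mu nu : sumn (join_parts mu nu) = (sumn mu + sumn nu)%N.
Proof. by rewrite (perm_sumn (perm_join_parts mu nu)) sumn_cat. Qed.

Definition parts (n : nat) : seq (seq nat) :=
  undup [seq mu <- flatten [seq words (iota 1 n) l | l <- iota 0 n.+1]
        | is_partition mu && (sumn mu == n)].

Lemma parts_uniq n : uniq (parts n).
Proof. exact: undup_uniq. Qed.

Lemma leq_size_sumn mu : 0%N \notin mu -> (size mu <= sumn mu)%N.
Proof. by elim: mu => //= n mu IH; rewrite inE negb_or => /andP[n0 /IH]; lia. Qed.

Lemma leq_mem_sumn mu n : n \in mu -> (n <= sumn mu)%N.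
Proof. by elim: mu => //= m mu IH; rewrite inE => /orP[/eqP->|/IH]; lia. Qed.

Lemma mem_parts n mu : (mu \in parts n) = is_partition mu && (sumn mu == n).
Proof.
rewrite mem_undup mem_filter; case: (boolP (is_partition mu)) => //= pmu.
case: eqP => //= <-; have mu0 := partition_notin0 pmu.
suff : mu \in flatten [seq words (iota 1 (sumn mu)) l | l <- iota 0 (sumn mu).+1] by [].
apply/flattenP; exists (words (iota 1 (sumn mu)) (size mu)).
  by apply/map_f; rewrite mem_iota /= add0n ltnS leq_size_sumn.
rewrite mem_words eqxx /=; apply/allP => i imu /=; rewrite mem_iota add1n ltnS leq_mem_sumn //.
by rewrite andbT lt0n; apply: contraNneq mu0 => <-.
Qed.

Section PowerSums.
Variable K : fieldType.
Hypothesis natr_neq0 : forall n, n.+1%:R != 0 :> K.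
Implicit Types (p : nat -> pseries K) (a b c F : seq nat -> K).

Definition Psi p a : pseries K :=
  fun e => \sum_(mu <- parts (mdeg e)) a mu * ppbprod p mu e.

(** A monomial with exponents [mu] arises from [p_nu] only by distributing the parts
    of [nu] over its variables, so that [mu] is obtained by merging parts of [nu]. *)
Lemma ppbprod_triangular mu nu : is_partition mu -> is_partition nu ->
  ppbprod (@ppow_sum K) nu (zmon mu [seq i%:Z | i <- iota 0 (size mu)]) != 0 ->
  (size mu <= size nu)%N /\ (size nu = size mu -> nu = mu).
Proof.
move=> pmu pnu /ppbprod_neq0 - /(_ (partition_notin0 pnu)) [w [sw E]].
set v := [seq i%:Z | i <- iota 0 (size mu)] in E.
have sv : size v = size mu by rewrite size_map size_iota.
have uv : uniq v by rewrite map_inj_uniq ?iota_uniq // => i j [].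
have vw : {subset v <= w}.
  move=> x; rewrite -(zmon_supp x (partition_notin0 pmu) sv) E.
  by rewrite zmon_supp // partition_notin0.
split; first by rewrite -sv -sw uniq_leq_size.
move=> snu; have wv : (size w <= size v)%N by rewrite sw sv snu.
have [_ vw'] := uniq_min_size uv vw wv; have uw := leq_size_uniq uv vw wv.
apply: (sorted_eq geq_trans geq_anti); try by case/andP: pmu; case/andP: pnu.
rewrite -(map_zmon uw sw) -(map_zmon uv sv) E; apply: perm_map.
by apply: uniq_perm => // x; rewrite vw'.
Qed.

Lemma ppbprod_diag mu : is_partition mu ->
  ppbprod (@ppow_sum K) mu (zmon mu [seq i%:Z | i <- iota 0 (size mu)]) != 0.
Proof.
move=> pmu; set v := [seq i%:Z | i <- iota 0 (size mu)].
have sv : size v = size mu by rewrite size_map size_iota.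
have uv : uniq v by rewrite map_inj_uniq ?iota_uniq // => i j [].
have mu0 := partition_notin0 pmu.
rewrite (@ppbprodE _ _ _ v) //; last by move=> x; rewrite zmon_supp.
apply: natr_gt0_neq0 => //; rewrite -has_count; apply/hasP; exists v; last exact: eqxx.
by rewrite mem_words sv eqxx; apply/allP.
Qed.

(** Linear independence of the products of power sums, by descending induction on
    the length of [mu]: at a monomial with exponents [mu] only [p_mu] and the
    products of more power sums contribute. *)
Lemma Psi_inj a b : Psi (@ppow_sum K) a = Psi (@ppow_sum K) b ->
  forall mu, is_partition mu -> a mu = b mu.
Proof.
move=> ab mu; move: {2}(sumn mu - size mu)%N (leqnn (sumn mu - size mu)) => k.
elim/ltn_ind: k mu => k IH mu muk pmu.
have := congr1 (@^~ (zmon mu [seq i%:Z | i <- iota 0 (size mu)])) ab.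
rewrite /Psi mdeg_zmon ?size_map ?size_iota //.
have mup : mu \in parts (sumn mu) by rewrite mem_parts pmu eqxx.
rewrite !(bigD1_seq mu) ?parts_uniq //= => E.
set P := fun nu => ppbprod (@ppow_sum K) nu (zmon mu [seq i%:Z | i <- iota 0 (size mu)]).
suff E2 : \sum_(nu <- parts (sumn mu) | nu != mu) a nu * P nu =
          \sum_(nu <- parts (sumn mu) | nu != mu) b nu * P nu.
  by move: E; rewrite E2 => /addIr/(mulIf (ppbprod_diag pmu)).
rewrite big_seq_cond [RHS]big_seq_cond; apply: eq_bigr => nu.
rewrite mem_parts => /andP[/andP[pnu /eqP snu] numu].
have [->|H] := eqVneq (P nu) 0.
  by rewrite !mulr0.
have [le imp] := ppbprod_triangular pmu pnu H; congr (_ * _).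
have ne : size nu != size mu by apply: contraNneq numu => /imp ->.
have := leq_size_sumn (partition_notin0 pnu); rewrite snu => lenu.
apply: (IH (sumn nu - size nu)%N) => //; apply: leq_trans muk.
have lt : (size mu < size nu)%N by rewrite ltn_neqAle eq_sym ne.
by rewrite snu ltn_sub2l // (leq_trans lt).
Qed.

(** The product of the coefficients when [p_mu p_nu] is read as [p] of the union of
    [mu] and [nu]. *)
Definition conv a b : seq nat -> K := fun la =>
  \sum_(k < (sumn la).+1) \sum_(mu <- parts k) \sum_(nu <- parts (sumn la - k) | join_parts mu nu == la)
    a mu * b nu.

Lemma Psi_conv p a b : graded p -> Psi p a * Psi p b = Psi p (conv a b).
Proof.
move=> gp; apply/funext => e; set n := mdeg e.
pose G k := \sum_(mu <- parts k) \sum_(nu <- parts (n - k)) a mu * b nu * ppbprod p (join_parts mu nu) e.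
transitivity (\sum_(k < n.+1) G k).
  rewrite cfM /G.
  transitivity (\sum_(k < n.+1) \sum_(d <- msub e | mdeg d == k) Psi p a d * Psi p b (e `\` d)%mset).
    rewrite (exchange_big_dep xpredT) //=; apply: eq_big_seq => d; rewrite mem_msub => de.
    have dn : (mdeg d < n.+1)%N by rewrite ltnS mdeg_sub.
    rewrite (big_pred1 (Ordinal dn)) // => k /=; by rewrite eq_sym.
  apply: eq_bigr => k _.
  transitivity (\sum_(d <- msub e | mdeg d == k) \sum_(mu <- parts k) \sum_(nu <- parts (n - k))
     (a mu * b nu) * (ppbprod p mu d * ppbprod p nu (e `\` d)%mset)).
    rewrite big_seq_cond [RHS]big_seq_cond; apply: eq_bigr => d; rewrite mem_msub => /andP[de /eqP dk].
    rewrite /Psi dk; have -> : mdeg (e `\` d)%mset = (n - k)%N.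
      by apply/eqP; rewrite -(eqn_add2l k) -{1}dk -mdegB // subnKC // -ltnS.
    rewrite mulr_suml; apply: eq_bigr => mu _; rewrite mulr_sumr; apply: eq_bigr => nu _.
    by rewrite mulrACA.
  rewrite exchange_big; apply: eq_big_seq => mu; rewrite mem_parts => /andP[pmu /eqP smu].
  rewrite exchange_big; apply: eq_big_seq => nu; rewrite mem_parts => /andP[pnu /eqP snu].
  rewrite -mulr_sumr; congr (_ * _); rewrite (perm_ppbprod _ (perm_join_parts mu nu)) ppbprod_cat cfM.
  rewrite big_mkcond; apply: eq_bigr => d _; case: eqP => // /eqP dk; apply/esym.
  have [->|/(graded_ppbprod gp (partition_notin0 pmu)) E] := eqVneq (ppbprod p mu d) 0; first by rewrite mul0r.
  by rewrite E smu eqxx in dk.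
rewrite /Psi -/n /conv.
transitivity (\sum_(la <- parts n) \sum_(k < n.+1) \sum_(mu <- parts k)
   \sum_(nu <- parts (n - k) | join_parts mu nu == la) a mu * b nu * ppbprod p la e); last first.
  apply: eq_big_seq => la; rewrite mem_parts => /andP[pla /eqP ->].
  rewrite mulr_suml; apply: eq_bigr => k _; rewrite mulr_suml; apply: eq_bigr => mu _.
  by rewrite mulr_suml.
rewrite exchange_big; apply: eq_bigr => k _; rewrite exchange_big /G.
apply: eq_big_seq => mu; rewrite mem_parts => /andP[pmu /eqP smu].
rewrite (exchange_big_dep xpredT) //; apply: eq_big_seq => nu; rewrite mem_parts => /andP[pnu /eqP snu].
rewrite -big_filter (_ : [seq la <- _ | _] = [:: join_parts mu nu]) ?big_seq1 //.
have jn : join_parts mu nu \in parts n.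
  by rewrite mem_parts join_parts_partition // sumn_join_parts smu snu subnKC ?eqxx // -ltnS.
apply: perm_small_eq => //; apply: uniq_perm; rewrite ?filter_uniq ?parts_uniq //.
move=> la; rewrite mem_filter mem_seq1; apply/andP/eqP => [[/eqP ->]//|->].
by split; first exact/eqP.
Qed.

Definition weighted a : seq nat -> K := fun mu => (sumn mu)%:R * a mu.

Lemma euler_Psi p a : euler (Psi p a) = Psi p (weighted a).
Proof.
apply/funext => e; rewrite /euler /Psi mulr_sumr; apply: eq_big_seq => mu.
by rewrite mem_parts /weighted => /andP[_ /eqP ->]; rewrite mulrA.
Qed.

(** The relation [is_log] read on coefficients; it no longer mentions the power
    sums, and so passes from the variables [z] to the variables [w]. *)
Definition log_coefs c F :=
  [/\ c [::] = 1, F [::] = 0 &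
      forall la, is_partition la -> weighted c la = conv c (weighted F) la].

Lemma parts0 : parts 0 = [:: [::]].
Proof. by []. Qed.

Lemma Psi_mset0 p a : Psi p a mset0 = a [::].
Proof. by rewrite /Psi mdeg0 parts0 big_seq1 /ppbprod big_nil /p1 eqxx mulr1. Qed.

Lemma eq_Psi p a b : (forall la, is_partition la -> a la = b la) -> Psi p a = Psi p b.
Proof.
move=> ab; apply/funext => e; apply: eq_big_seq => la; rewrite mem_parts => /andP[pla _].
by rewrite ab.
Qed.

Lemma is_log_Psi p c F : graded p -> log_coefs c F -> is_log (Psi p c) (Psi p F).
Proof.
move=> gp [c1 F0 cF]; split; rewrite ?Psi_mset0 //.
by rewrite !euler_Psi Psi_conv //; apply: eq_Psi.
Qed.

Lemma log_coefs_is_log c F :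
  is_log (Psi (@ppow_sum K) c) (Psi (@ppow_sum K) F) -> log_coefs c F.
Proof.
case; rewrite !Psi_mset0 !euler_Psi => c1 F0 E; split=> //.
by apply: Psi_inj; rewrite E Psi_conv //; apply: graded_ppow_sum.
Qed.

End PowerSums.

(** * The logarithm of the symmetric product *)

Section BracketLog.
Variable K : fieldType.
Hypothesis natr_neq0 : forall n, n.+1%:R != 0 :> K.

Variable small : nat -> K -> Prop.
Hypothesis fil : filtration small.

Definition mpow (m : monomial) (k : nat) : monomial := iter k (msetD m) mset0.

Lemma mpowE m k x : mpow m k x = (k * m x)%N.
Proof. by elim: k => [|k IH]; rewrite ?mset0E //= msetE2 IH mulSn. Qed.

Lemma monoX m k : (mono K m) ^+ k = mono K (mpow m k).
Proof. by elim: k => [|k IH]; [rewrite expr0 mono0 | rewrite exprS IH monoM]. Qed.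

Lemma mpow_zmon mu w k : size w = size mu ->
  mpow (zmon mu w) k = zmon [seq (k * n)%N | n <- mu] w.
Proof.
move=> sw; apply/msetP => x; rewrite mpowE.
elim: mu w sw => [|n mu IH] [|i w] //= sw; first by rewrite zmon_nil mset0E muln0.
case: sw => sw; rewrite !zmon_cons !msetE2 mulnDr IH // /zvar_pow !msetnE.
by case: eqP => //; rewrite muln0.
Qed.

Definition linear_factor (omega : K) (m : monomial) : pseries K :=
  padd (@p1 K) (fun e => omega * (e == m)%:R).

Definition linear_log (omega : K) (m : monomial) : pseries K :=
  fun e => \sum_(k < mdeg e) (-1) ^+ k / k.+1%:R * omega ^+ k.+1 * (e == mpow m k.+1)%:R.

Lemma pscaleX (c : K) (f : pseries K) k : (pscale c f) ^+ k = pscale (c ^+ k) (f ^+ k).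
Proof.
elim: k => [|k IH]; apply/funext => e; first by rewrite /pscale !expr0 mul1r.
rewrite !exprS IH cfM /pscale cfM mulr_sumr; apply: eq_bigr => d _.
by rewrite mulrACA.
Qed.

Lemma is_log_linear_factor omega m : m != mset0 ->
  is_log (linear_factor omega m) (linear_log omega m).
Proof.
move=> m0.
have f1 : linear_factor omega m mset0 = 1.
  by rewrite /linear_factor /padd /p1 eqxx eq_sym (negPf m0) mulr0 addr0.
suff -> : linear_log omega m = plog (linear_factor omega m) by apply: is_log_plog.
apply/funext => e; rewrite (@plogE _ _ (mdeg e) e f1) //; apply: eq_bigr => k _.
have -> : (linear_factor omega m : pseries K) - 1 = pscale omega (mono K m).
  by apply/funext => d; rewrite cfD cfN /linear_factor /padd addrC addKr.
by rewrite pscaleX monoX /pscale mulrA.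
Qed.

Variable mu : seq nat.
Hypothesis mu_part : is_partition mu.
Hypothesis mu_neq0 : mu <> [::].
Variable omega : K.

Definition bracket_log : pseries K :=
  fun e => \sum_(k < mdeg e) (-1) ^+ k / k.+1%:R * omega ^+ k.+1 *
             ppbprod (@ppow_sum K) [seq (k.+1 * n)%N | n <- mu] e.

Lemma zmon_neq0 (w : (size mu).-tuple int) : zmon mu w != mset0.
Proof.
rewrite -mdeg_eq0 mdeg_zmon ?size_tuple // -lt0n.
have := leq_size_sumn (partition_notin0 mu_part); case: (mu) mu_neq0 => //= n nu _; lia.
Qed.

Lemma scale_notin0 k : (0 < k)%N -> 0%N \notin [seq (k * n)%N | n <- mu].
Proof.
move=> k0; apply/mapP => -[n nmu] /esym/eqP; rewrite muln_eq0 -leqn0 leqNgt k0 /= => /eqP n0.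
by have := partition_notin0 mu_part; rewrite -n0 nmu.
Qed.

(** Once [S] contains all tuples of variables of [e], the sum counts the ways to
    write [e] as a product of powers with exponents [k * mu]. *)
Lemma eventually_count e k : (0 < k)%N ->
  eventually [set: (size mu).-tuple int] (fun S =>
    \sum_(i <- S) ((e == mpow (zmon mu i) k)%:R : K)
    = ppbprod (@ppow_sum K) [seq (k * n)%N | n <- mu] e).
Proof.
move=> k0; set r := undup (enum_mset e).
exists [fset t in pmap insub (words r (size mu)) : seq ((size mu).-tuple int)]%fset; split => // S S1 _.
rewrite (@ppbprodE _ _ _ r) ?undup_uniq ?scale_notin0 //;
  last by move=> x; rewrite mem_undup.
transitivity ((count (fun i : (size mu).-tuple int => e == mpow (zmon mu i) k) S)%:R : K).
  by rewrite -sum1_count natr_sum [RHS]big_mkcond; apply: eq_bigr => i _; case: eqP.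
congr (_%:R); rewrite size_map -!size_filter.
rewrite -[LHS](size_map (fun t : (size mu).-tuple int => tval t)).
apply/perm_size/uniq_perm.
- by rewrite map_inj_uniq ?filter_uniq ?fset_uniq //; apply: val_inj.
- by rewrite filter_uniq ?words_uniq ?undup_uniq.
move=> w; rewrite mem_filter; apply/mapP/andP => [[t]|[/eqP ew wr]].
  rewrite mem_filter => /andP[/eqP et tS] ->; rewrite -mpow_zmon ?size_tuple // et; split=> //.
  rewrite mem_words size_tuple eqxx; apply/allP => x xt /=.
  rewrite mem_undup et mpow_zmon ?size_tuple // -[_ \in _]/(x \in zmon _ t).
  by rewrite zmon_supp ?scale_notin0 // size_map size_tuple.
have sw : size w == size mu by move: wr; rewrite mem_words => /andP[].
exists (Tuple sw) => //; rewrite mem_filter /= mpow_zmon ?(eqP sw) // ew eqxx /=.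
by apply: S1; rewrite /= inE mem_pmap_sub.
Qed.

Lemma is_log_bracket : is_log (pexp bracket_log) bracket_log.
Proof. by apply: is_log_pexp => //; rewrite /bracket_log mdeg0 big_ord0. Qed.

Lemma has_pprod_bracket :
  has_pprod small [set: (size mu).-tuple int]
    (fun i => linear_factor omega (zmon mu i)) (pexp bracket_log).
Proof.
refine (has_pprod_is_log natr_neq0 fil
  (L := fun i : (size mu).-tuple int => linear_log omega (zmon mu i)) (M := bracket_log) _ _ _).
- by move=> i _; apply/is_log_linear_factor/zmon_neq0.
- exact: is_log_bracket.
move=> e; rewrite /linear_log /bracket_log.
apply: (eq_tends (u := fun S : {fset (size mu).-tuple int} => \sum_(k < mdeg e) \sum_(i <- S)
  (-1) ^+ k / k.+1%:R * omega ^+ k.+1 * (e == mpow (zmon mu i) k.+1)%:R)) => [S _|].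
  by rewrite exchange_big.
apply: (tends_sum fil) => k _ B.
apply: eventually_and (eventually_count e (ltn0Sn k)) (eventually_count e (ltn0Sn k)) => S _ E _.
by rewrite -mulr_sumr E subrr; apply: small0.
Qed.

End BracketLog.

(** * Moebius inversion over the common divisors of the parts *)

Lemma primes_mulp p l : prime p -> (0 < l)%N -> ~~ (p %| l)%N ->
  perm_eq (primes (p * l)) (p :: primes l).
Proof.
move=> pp l0 pl; apply: uniq_perm; rewrite ?primes_uniq //=.
  by rewrite primes_uniq andbT mem_primes pp l0.
by move=> r; rewrite primesM ?(prime_gt0 pp) // primes_prime // mem_seq1 in_cons.
Qed.

Lemma moebius_mulp p l : prime p -> (0 < l)%N ->
  moebius (p * l) = if (p %| l)%N then 0 else - moebius l.
Proof.
move=> pp l0; have p0 := prime_gt0 pp; case: ifP => pl.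
  rewrite /moebius ifF //; apply/negbTE/allPn; exists p.
    by rewrite mem_primes pp muln_gt0 p0 l0 dvdn_mulr.
  rewrite lognM // logn_prime // eqxx add1n eqSS -lt0n.
  by rewrite logn_gt0 mem_primes pp l0.
have P := primes_mulp pp l0 (negbT pl).
rewrite /moebius (perm_all _ P) (perm_size P) /=.
rewrite lognM // logn_prime // eqxx (_ : logn p l = 0%N); last first.
  by apply/eqP; rewrite -leqn0 leqNgt logn_gt0 mem_primes pl !andbF.
rewrite (_ : all _ _ = all (fun r => logn r l == 1%N) (primes l)); last first.
  apply: eq_in_all => r; rewrite mem_primes => /and3P[pr _ rl].
  have [E|ne] := eqVneq r p; first by rewrite -E rl in pl.
  by rewrite lognM // logn_prime // (negPf ne).
by rewrite addn0 eqxx /=; case: ifP => _; rewrite ?exprS ?mulN1r ?oppr0.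
Qed.

(** Multiplying by a prime divisor of [n] pairs off the divisors that it does not
    divide with the divisors that it divides exactly once. *)
Lemma sum_moebius n : (0 < n)%N -> \sum_(l <- divisors n) moebius l = (n == 1%N)%:R.
Proof.
move=> n0; case: (eqVneq n 1%N) => [->|n1]; first by rewrite big_seq1.
have n2 : (1 < n)%N by rewrite ltn_neqAle eq_sym n1.
set p := pdiv n; have pp : prime p := pdiv_prime n2; have p0 := prime_gt0 pp.
have pn : (p %| n)%N by apply: pdiv_dvd.
rewrite (bigID (fun l => p %| l)%N) /=.
have -> : \sum_(l <- divisors n | (p %| l)%N) moebius l
        = \sum_(l <- divisors (n %/ p)) moebius (p * l).
  rewrite -big_filter -(big_map (muln p) xpredT moebius); apply: perm_big.
  have np0 : (0 < n %/ p)%N by rewrite divn_gt0 // dvdn_leq.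
  apply: uniq_perm; first by rewrite filter_uniq ?divisors_uniq.
    by rewrite map_inj_uniq ?divisors_uniq // => i j /eqP; rewrite eqn_pmul2l // => /eqP.
  move=> l; rewrite mem_filter -dvdn_divisors //; apply/andP/mapP => [[/dvdnP[k ->] kn]|[k]].
    exists k; last by rewrite mulnC.
    by rewrite -dvdn_divisors // dvdn_divRL // .
  rewrite -dvdn_divisors // dvdn_divRL // => kn ->; split; first exact: dvdn_mulr.
  by rewrite mulnC.
have -> : \sum_(l <- divisors (n %/ p)) moebius (p * l)
        = \sum_(l <- divisors n | ~~ (p %| l)%N) - moebius l; last by rewrite sumrN addNr.
have np0 : (0 < n %/ p)%N by rewrite divn_gt0 // dvdn_leq.
transitivity (\sum_(l <- divisors (n %/ p) | ~~ (p %| l)%N) - moebius l).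
  rewrite [RHS]big_mkcond; apply: eq_big_seq => l; rewrite -dvdn_divisors // => ln.
  by rewrite moebius_mulp ?(dvdn_gt0 np0) //; case: ifP.
rewrite -big_filter -[RHS]big_filter; apply: perm_big.
apply: uniq_perm; rewrite ?filter_uniq ?divisors_uniq // => l.
rewrite !mem_filter -!dvdn_divisors //; case: (boolP (p %| l)%N) => //= pl.
apply/idP/idP => [|ln]; first by move/dvdn_trans; apply; apply: dvdn_div.
rewrite dvdn_divRL // Gauss_dvd ?ln //; first by rewrite coprime_sym prime_coprime.
Qed.

Definition gcd_parts (mu : seq nat) : nat := foldr gcdn 0%N mu.

Lemma dvdn_gcd_parts k mu : (k %| gcd_parts mu)%N = all (fun i => k %| i)%N mu.
Proof. by elim: mu => [|n mu IH] /=; rewrite ?dvdn0 // dvdn_gcd IH. Qed.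

Lemma gcd_parts_gt0 mu : nonempty_partitions mu -> (0 < gcd_parts mu)%N.
Proof.
move=> [pmu mu0]; rewrite lt0n; apply/eqP => g0.
have := dvdn_gcd_parts 0 mu; rewrite g0 dvdnn => /esym; case: mu pmu mu0 {g0} => // n mu pmu _ /=.
rewrite dvd0n => /andP[/eqP n0 _]; have := partition_notin0 pmu; by rewrite n0 inE eqxx.
Qed.

Lemma sum_common_divisors (R : nmodType) mu (G : nat -> R) : nonempty_partitions mu ->
  \sum_(1 <= k < (sumn mu).+1 | all (fun i => k %| i)%N mu) G k
  = \sum_(k <- divisors (gcd_parts mu)) G k.
Proof.
move=> pmu; have g0 := gcd_parts_gt0 pmu.
rewrite -big_filter; apply: perm_big; apply: uniq_perm.
- by rewrite filter_uniq ?iota_uniq.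
- exact: divisors_uniq.
move=> k; rewrite mem_filter mem_index_iota -dvdn_divisors // dvdn_gcd_parts.
apply/andP/idP => [[]//|kmu]; split=> //; apply/andP; split.
  by rewrite (dvdn_gt0 g0) // dvdn_gcd_parts.
case: mu pmu {g0} kmu => [[]//|n mu] [pmu _] /andP[kn _].
have n0 : (0 < n)%N by have := partition_notin0 pmu; rewrite inE negb_or lt0n eq_sym => /andP[].
by rewrite ltnS /=; apply: leq_trans (leq_addr _ _); apply: dvdn_leq.
Qed.

Lemma part_div_partition mu k : nonempty_partitions mu -> (0 < k)%N ->
  all (fun i => k %| i)%N mu -> nonempty_partitions (part_div mu k).
Proof.
move=> [/andP[srt mu0] ne] k0 kmu; split; last by case: (mu) ne.
apply/andP; split.
  have H : {homo (fun i => i %/ k)%N : x y / geq x y} by move=> x y; apply: leq_div2r.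
  exact: homo_sorted H _ srt.
apply/mapP => -[i imu] E; have := divnK (allP kmu _ imu); rewrite -E mul0n => i0.
by rewrite -i0 in imu; rewrite imu in mu0.
Qed.

Lemma part_divM mu k l : part_div (part_div mu k) l = part_div mu (k * l).
Proof. by rewrite /part_div -map_comp; apply: eq_map => i /=; rewrite divnMA. Qed.

Lemma part_divK mu k : all (fun i => k %| i)%N mu ->
  [seq (k * i)%N | i <- part_div mu k] = mu.
Proof.
move=> /allP kmu; rewrite /part_div -map_comp -[RHS]map_id; apply/eq_in_map => i /kmu /=.
by move=> ki; rewrite mulnC divnK.
Qed.

Lemma scale_part_div mu k : (0 < k)%N -> part_div [seq (k * i)%N | i <- mu] k = mu.
Proof.
by move=> k0; rewrite /part_div -map_comp -[RHS]map_id; apply: eq_map => i /=; rewrite mulKn.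
Qed.

Lemma gcd_part_div mu k : (0 < k)%N -> all (fun i => k %| i)%N mu ->
  gcd_parts (part_div mu k) = (gcd_parts mu %/ k)%N.
Proof.
move=> k0; elim: mu => [|n mu IH] /=; first by rewrite div0n.
move=> /andP[kn kmu]; rewrite IH //; rewrite -dvdn_gcd_parts in kmu.
by rewrite -{2}(divnK kn) -{2}(divnK kmu) -muln_gcdl mulnK.
Qed.

Lemma divisors_shift G k : (0 < G)%N -> (k %| G)%N ->
  perm_eq [seq n <- divisors G | (k %| n)%N] [seq (k * l)%N | l <- divisors (G %/ k)].
Proof.
move=> G0 kG; have k0 := dvdn_gt0 G0 kG.
have Gk0 : (0 < G %/ k)%N by rewrite divn_gt0 // dvdn_leq.
apply: uniq_perm; first by rewrite filter_uniq ?divisors_uniq.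
  by rewrite map_inj_uniq ?divisors_uniq // => i j /eqP; rewrite eqn_pmul2l // => /eqP.
move=> n; rewrite mem_filter -dvdn_divisors //; apply/andP/mapP => [[/dvdnP[l ->] lG]|[l]].
  by exists l; rewrite 1?mulnC // -dvdn_divisors // dvdn_divRL.
rewrite -dvdn_divisors // dvdn_divRL // => lG ->; split; first exact: dvdn_mulr.
by rewrite mulnC.
Qed.

Lemma divn_div n k : (0 < n)%N -> (k %| n)%N -> (n %/ (n %/ k))%N = k.
Proof. by move=> n0 kn; rewrite divnA // mulKn. Qed.

(** Both sides run over the chains of divisors [k | n | G], with [l = n/k]. *)
Lemma sum_divisors_divisors (R : nmodType) G (H : nat -> nat -> R) : (0 < G)%N ->
  \sum_(k <- divisors G) \sum_(l <- divisors (G %/ k)) H k l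
  = \sum_(n <- divisors G) \sum_(l <- divisors n) H (n %/ l)%N l.
Proof.
move=> G0.
transitivity (\sum_(k <- divisors G) \sum_(n <- divisors G | (k %| n)%N) H k (n %/ k)%N).
  apply: eq_big_seq => k; rewrite -dvdn_divisors // => kG.
  rewrite -[RHS]big_filter (perm_big _ (divisors_shift G0 kG)) big_map.
  by apply: eq_bigr => l _; rewrite mulKn // (dvdn_gt0 G0).
rewrite (exchange_big_dep xpredT) //=; apply: eq_big_seq => n; rewrite -dvdn_divisors // => nG.
have n0 := dvdn_gt0 G0 nG.
transitivity (\sum_(k <- divisors n) H k (n %/ k)%N).
  rewrite -big_filter; apply: perm_big; apply: uniq_perm; rewrite ?filter_uniq ?divisors_uniq // => k.
  rewrite mem_filter -!dvdn_divisors //; apply/andP/idP => [[]//|kn].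
  by split=> //; apply: dvdn_trans nG.
transitivity (\sum_(k <- [seq (n %/ l)%N | l <- divisors n]) H k (n %/ k)%N).
  apply: perm_big; apply: uniq_perm; rewrite ?divisors_uniq //.
    rewrite map_inj_in_uniq ?divisors_uniq // => i j; rewrite -!dvdn_divisors // => ni nj E.
    by rewrite -(divn_div n0 ni) E divn_div.
  move=> k; rewrite -dvdn_divisors //; apply/idP/mapP => [kn|[l]].
    exists (n %/ k)%N; last by rewrite divn_div.
    rewrite -dvdn_divisors //.
    exact: dvdn_div.
  by rewrite -dvdn_divisors // => ln ->; apply: dvdn_div.
rewrite big_map; apply: eq_big_seq => l; rewrite -dvdn_divisors // => ln.
by rewrite divn_div.
Qed.

(** * Substitutions in rational functions *)

Lemma polyC_natr_neq0 (R : nzRingType) n :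
  (n.+1%:R != 0 :> R) -> (n.+1%:R != 0 :> {poly R}).
Proof. by move=> h; rewrite -polyC_natr polyC_eq0. Qed.

Lemma tofrac_natr_neq0 (R : idomainType) n :
  (n.+1%:R != 0 :> R) -> (n.+1%:R != 0 :> {fraction R}).
Proof. by move=> h; rewrite -(rmorph_nat (@FracField.tofrac R)) tofrac_eq0. Qed.

Lemma Qs_natr_neq0 n : (n.+1%:R : Qs) != 0.
Proof. by apply/tofrac_natr_neq0/polyC_natr_neq0; rewrite pnatr_eq0. Qed.

Lemma Qqt_natr_neq0 n : (n.+1%:R : Qqt) != 0.
Proof.
by apply: tofrac_natr_neq0; do 2!apply: polyC_natr_neq0; rewrite pnatr_eq0.
Qed.

Lemma fracE (R : idomainType) (x : {fraction R}) :
  x = FracField.tofrac (\n_(generic_quotient.repr x)) / FracField.tofrac (\d_(generic_quotient.repr x)).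
Proof.
set r := generic_quotient.repr x.
have d0 : FracField.tofrac (\d_r) != 0 :> {fraction R} by rewrite tofrac_eq0 denom_ratioP.
apply: (mulIf d0); rewrite divfK // -[x]generic_quotient.reprK -/r.
unlock FracField.tofrac; rewrite -[LHS]FracField.pi_mul.
apply/generic_quotient.eqmodP; rewrite /= FracField.equivfE /FracField.mulf.
by rewrite !numden_Ratio ?mulr1 ?oner_neq0 ?denom_ratioP // mulrC.
Qed.

Lemma fracP (R : idomainType) (x : {fraction R}) :
  exists u v : R, v != 0 /\ x = FracField.tofrac u / FracField.tofrac v.
Proof.
by exists (\n_(generic_quotient.repr x)), (\d_(generic_quotient.repr x)); rewrite denom_ratioP -fracE.
Qed.

Section RatMorphism.
Variable L : fieldType.
Hypothesis natr_neq0 : forall n, n.+1%:R != 0 :> L.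

Lemma intr_neq0 (z : int) : z != 0 -> z%:~R != 0 :> L.
Proof.
case: z => [[|n]|n] // _; first by rewrite -pmulrn.
by rewrite NegzE mulrNz oppr_eq0 -pmulrn.
Qed.

Lemma ratr_frac (a b : int) : b != 0 -> ratr (a%:~R / b%:~R) = a%:~R / b%:~R :> L.
Proof.
move=> b0; rewrite /ratr; set r := a%:~R / b%:~R.
apply/eqP; rewrite eqr_div ?intr_neq0 ?denq_neq0 // -!intrM; apply/eqP; congr (_%:~R).
apply: (@intr_inj rat); rewrite !intrM; apply/eqP; rewrite -eqr_div ?intr_eq0 ?denq_neq0 //.
by rewrite divq_num_den.
Qed.

Lemma ratr_additive : zmod_morphism (@ratr L).
Proof.
move=> x y; rewrite -[x]divq_num_den -[y]divq_num_den.
have x0 := intr_neq0 (denq_neq0 x); have y0 := intr_neq0 (denq_neq0 y).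
rewrite -mulNr addf_div ?intr_eq0 ?denq_neq0 // -!(rmorphM, rmorphN, rmorphD) /=.
rewrite !ratr_frac ?mulf_neq0 ?denq_neq0 //.
by rewrite !(rmorphM, rmorphN, rmorphD) /= -mulNr addf_div.
Qed.

Lemma ratr_multiplicative : monoid_morphism (@ratr L).
Proof.
split=> [|x y]; first by have := @ratr_frac 1 1 isT; rewrite !divr1.
rewrite -[x]divq_num_den -[y]divq_num_den mulf_div -!rmorphM /=.
by rewrite !ratr_frac ?mulf_neq0 ?denq_neq0 // !rmorphM mulf_div.
Qed.

(** The hypothesis is an argument so that the ring structure of the morphism can be
    inferred from the term; the same holds for [subst_mor]. *)
Definition rat_embed (_ : forall n, n.+1%:R != 0 :> L) (r : rat) : L := ratr r.
Local Notation embed := (rat_embed natr_neq0).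

HB.instance Definition _ := GRing.isZmodMorphism.Build rat L embed ratr_additive.
HB.instance Definition _ := GRing.isMonoidMorphism.Build rat L embed ratr_multiplicative.

Lemma rat_morph_uniq (R : comNzRingType) (f : {rmorphism rat -> R}) (h : {rmorphism R -> L}) r :
  h (f r) = ratr r.
Proof.
rewrite -{1}[r]divq_num_den; have d0 := intr_neq0 (denq_neq0 r).
apply: (mulIf d0); rewrite -{1}(rmorph_int h) -{1}(rmorph_int f) -!rmorphM.
by rewrite divfK ?intr_eq0 ?denq_neq0 // !rmorph_int /ratr divfK.
Qed.

Variables a b : L.

Definition inner_eval (c : {poly rat}) : L := horner_eval b (map_poly embed c).

Lemma inner_eval_additive : zmod_morphism inner_eval.
Proof. by move=> c d; rewrite /inner_eval !rmorphB. Qed.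

Lemma inner_eval_multiplicative : monoid_morphism inner_eval.
Proof. by split=> [|c d]; rewrite /inner_eval ?rmorph1 ?rmorphM. Qed.

HB.instance Definition _ :=
  GRing.isZmodMorphism.Build {poly rat} L inner_eval inner_eval_additive.
HB.instance Definition _ :=
  GRing.isMonoidMorphism.Build {poly rat} L inner_eval inner_eval_multiplicative.

Definition outer_eval (p : {poly {poly rat}}) : L := horner_eval a (map_poly inner_eval p).

Lemma outer_eval_additive : zmod_morphism outer_eval.
Proof. by move=> c d; rewrite /outer_eval !rmorphB. Qed.

Lemma outer_eval_multiplicative : monoid_morphism outer_eval.
Proof. by split=> [|c d]; rewrite /outer_eval ?rmorph1 ?rmorphM. Qed.

HB.instance Definition _ :=
  GRing.isZmodMorphism.Build {poly {poly rat}} L outer_eval outer_eval_additive.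
HB.instance Definition _ :=
  GRing.isMonoidMorphism.Build {poly {poly rat}} L outer_eval outer_eval_multiplicative.

Lemma eval2E p : eval2 p a b = outer_eval p. Proof. by []. Qed.

Lemma outer_evalX : outer_eval 'X = a.
Proof. by rewrite /outer_eval map_polyX /horner_eval hornerX. Qed.

Lemma outer_evalC c : outer_eval c%:P = inner_eval c.
Proof. by rewrite /outer_eval map_polyC /horner_eval hornerC. Qed.

Lemma inner_evalX : inner_eval 'X = b.
Proof. by rewrite /inner_eval map_polyX /horner_eval hornerX. Qed.

Hypothesis outer_inj : forall p, outer_eval p = 0 -> p = 0.

Definition subst_mor (_ : forall p, outer_eval p = 0 -> p = 0) (x : Qqt) : L := subst x a b.
Local Notation subst_at := (subst_mor outer_inj).

(** The value does not depend on the fraction, because no denominator vanishes. *)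
Lemma subst_frac u v : v != 0 ->
  subst_at (FracField.tofrac u / FracField.tofrac v) = outer_eval u / outer_eval v.
Proof.
move=> v0; set x := FracField.tofrac u / _; rewrite /subst_mor /subst; set r := generic_quotient.repr x.
rewrite !eval2E; have E := fracE x; rewrite -/r {1}/x in E.
have d0 : \d_r != 0 by apply: denom_ratioP.
have nz w : w != 0 -> outer_eval w != 0 by apply: contra_neq; apply: outer_inj.
apply/eqP; rewrite eqr_div ?nz // -!rmorphM; apply/eqP; congr outer_eval.
move/eqP: E; rewrite eqr_div ?tofrac_eq0 // -!tofracM tofrac_eq => /eqP ->.
by [].
Qed.

Lemma subst_additive : zmod_morphism subst_at.
Proof.
move=> x y; have [u [v [v0 ->]]] := fracP x; have [u' [v' [v0' ->]]] := fracP y.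
have nz w : w != 0 -> outer_eval w != 0 by apply: contra_neq; apply: outer_inj.
rewrite -mulNr addf_div ?tofrac_eq0 // -!(rmorphM, rmorphN, rmorphD) /= !subst_frac ?mulf_neq0 //.
by rewrite !(rmorphM, rmorphN, rmorphD) /= -mulNr addf_div ?nz.
Qed.

Lemma subst_multiplicative : monoid_morphism subst_at.
Proof.
split=> [|x y].
  by rewrite -(divr1 1) -tofrac1 subst_frac ?oner_neq0 // rmorph1 divr1.
have [u [v [v0 ->]]] := fracP x; have [u' [v' [v0' ->]]] := fracP y.
by rewrite mulf_div -!rmorphM !subst_frac ?mulf_neq0 // !rmorphM mulf_div.
Qed.

HB.instance Definition _ := GRing.isZmodMorphism.Build Qqt L subst_at subst_additive.
HB.instance Definition _ := GRing.isMonoidMorphism.Build Qqt L subst_at subst_multiplicative.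

Lemma subst_tofrac p : subst_at (FracField.tofrac p) = outer_eval p.
Proof. by rewrite -[FracField.tofrac p]divr1 -tofrac1 subst_frac ?oner_neq0 // rmorph1 divr1. Qed.

End RatMorphism.

Local Notation tof := (@FracField.tofrac {poly {poly rat}}).

(** A morphism is determined by the images of [q] and [t]: rational numbers leave no
    choice. *)
Lemma rmorph_Qqt_eq (L : fieldType) (f g : {rmorphism Qqt -> L}) :
  (forall n, n.+1%:R != 0 :> L) -> f q = g q -> f t = g t -> f =1 g.
Proof.
move=> L0 fq ft x; have [u [v [v0 ->]]] := fracP x.
have E1 (c : {poly rat}) : f (tof c%:P) = g (tof c%:P).
  elim/poly_ind: c => [|c r IH]; first by rewrite !rmorph0.
  rewrite !rmorphD !rmorphM /= IH ft; congr (_ + _).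
  pose h := (tof \o polyC) \o polyC : {rmorphism rat -> Qqt}.
  by rewrite -[tof _]/(h r) !(rat_morph_uniq L0 h).
have E (w : {poly {poly rat}}) : f (tof w) = g (tof w).
  elim/poly_ind: w => [|w c IH]; first by rewrite !rmorph0.
  by rewrite !rmorphD !rmorphM /= IH fq E1.
by rewrite !fmorph_div !E.
Qed.

Lemma outer_eval_comp k (u : {poly rat}) p :
  outer_eval Qqt_natr_neq0 (q ^+ k) (FracField.tofrac u%:P) p
  = FracField.tofrac ((map_poly (comp_poly u) p) \Po 'X^k).
Proof.
have ->: q ^+ k = tof 'X^k by rewrite /q -tofracXn.
have E (c : {poly rat}) : inner_eval Qqt_natr_neq0 (tof u%:P) c = tof (c \Po u)%:P.
  rewrite /comp_poly -horner_map -[in RHS]horner_map /inner_eval /horner_eval; congr (_.[_]).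
  rewrite -!map_poly_comp; apply/polyP => i; rewrite !coef_map /=.
  pose h := (tof \o polyC) \o polyC : {rmorphism rat -> Qqt}.
  exact/esym/(rat_morph_uniq Qqt_natr_neq0 idfun h).
rewrite /comp_poly -horner_map /outer_eval /horner_eval; congr (_.[_]).
by apply/polyP => i; rewrite !coef_map /= E -[map_poly _ p]/(map_poly (comp_poly u) p) coef_map.
Qed.

(** Composition with non-constant polynomials is injective. *)
Lemma outer_eval_inj k (u : {poly rat}) : (0 < k)%N -> (1 < size u)%N ->
  forall p, outer_eval Qqt_natr_neq0 (q ^+ k) (FracField.tofrac u%:P) p = 0 -> p = 0.
Proof.
move=> k0 u1 p; rewrite outer_eval_comp => /eqP; rewrite tofrac_eq0 comp_poly_eq0; last first.
  by rewrite size_polyXn ltnS.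
move=> /eqP E; apply/polyP => i; rewrite coef0.
have := congr1 (fun r : {poly {poly rat}} => r`_i) E; rewrite coef0 coef_map /=.
by move/eqP; rewrite comp_poly_eq0 // => /eqP.
Qed.

(** * Rational functions of q and t *)

Lemma qsmall0 B : qsmall B 0.
Proof.
by exists 0, 'X^B; rewrite monic_neq0 ?monicXn // tofrac0 mul0r size_poly0 size_polyXn.
Qed.

Lemma leq_size_mulp (u v : {poly {poly rat}}) : u != 0 -> v != 0 ->
  (size (u * v)).+1 = (size u + size v)%N.
Proof.
move=> u0 v0; rewrite size_mul // prednK // addn_gt0 lt0n size_poly_eq0 u0 //.
Qed.

Lemma qsmallB B x y : qsmall B x -> qsmall B y -> qsmall B (x - y).
Proof.
move=> [u [v [v0 -> uv]]] [u' [v' [v0' -> uv']]].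
exists (u * v' - u' * v), (v * v'); split; first by rewrite mulf_neq0.
  by rewrite -mulNr addf_div ?tofrac_eq0 // -!(rmorphM, rmorphN, rmorphD) /= mulNr.
have := size_polyD (u * v') (- (u' * v)); rewrite size_polyN => H.
have Hvv := leq_size_mulp v0 v0'.
have Hv : (0 < size v)%N by rewrite lt0n size_poly_eq0.
have Hv' : (0 < size v')%N by rewrite lt0n size_poly_eq0.
have H1 : (size (u * v')%R + B <= size (v * v')%R)%N.
  have [u0|u0] := eqVneq u 0; first by move: uv; rewrite u0 mul0r size_poly0; lia.
  by have := leq_size_mulp u0 v0'; lia.
have H2 : (size (u' * v)%R + B <= size (v * v')%R)%N.
  have [u0|u0] := eqVneq u' 0; first by move: uv'; rewrite u0 mul0r size_poly0; lia.
  by have := leq_size_mulp u0 v0; lia.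
by apply: leq_trans (leq_add H (leqnn B)) _; rewrite addn_maxl geq_max H1.
Qed.

Lemma qsmall_le B C x : (B <= C)%N -> qsmall C x -> qsmall B x.
Proof.
move=> BC [u [v [v0 -> uv]]]; exists u, v; split=> //.
by apply: leq_trans uv; rewrite leq_add2l.
Qed.

Lemma qsmallM B C x y : qsmall B x -> qsmall C y -> qsmall (B + C) (x * y).
Proof.
move=> [u [v [v0 -> uv]]] [u' [v' [v0' -> uv']]].
have [u0|u0] := eqVneq u 0; first by rewrite u0 tofrac0 !mul0r; apply: qsmall0.
have [u0'|u0'] := eqVneq u' 0; first by rewrite u0' tofrac0 mul0r mulr0; apply: qsmall0.
exists (u * u'), (v * v'); split; first by rewrite mulf_neq0.
  by rewrite mulf_div !tofracM.
have := leq_size_mulp v0 v0'; have := leq_size_mulp u0 u0'; lia.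
Qed.

Lemma QqtP (x : Qqt) : exists u v : {poly {poly rat}},
  v != 0 /\ x = FracField.tofrac u / FracField.tofrac v.
Proof. exact: fracP. Qed.

Lemma qsmall_scale c : exists C, forall B x, qsmall (B + C) x -> qsmall B (c * x).
Proof.
have [u' [v' [v0' ->]]] := QqtP c; exists (size u') => B x [u [v [v0 -> uv]]].
have [u0|u0] := eqVneq u 0; first by rewrite u0 tofrac0 mul0r mulr0; apply: qsmall0.
have [u0'|u0'] := eqVneq u' 0; first by rewrite u0' tofrac0 !mul0r; apply: qsmall0.
exists (u' * u), (v' * v); split; first by rewrite mulf_neq0.
  by rewrite mulf_div !tofracM.
have Hv' : (0 < size v')%N by rewrite lt0n size_poly_eq0.
have := leq_size_mulp v0' v0; have := leq_size_mulp u0' u0; lia.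
Qed.

(** The degree of the denominator minus that of the numerator depends only on the
    fraction. *)
Lemma qsmall_eq0 x : (forall B, qsmall B x) -> x = 0.
Proof.
have [u0 [v0 [nv0 ->]]] := QqtP x => H.
have [u00|nu0] := eqVneq u0 0; first by rewrite u00 tofrac0 mul0r.
have {H} := H (size v0).+1; rewrite /qsmall => -[u [v [nv E uv]]].
move/eqP: E; rewrite eqr_div ?tofrac_eq0 // -!tofracM tofrac_eq => /eqP E.
have nu : u != 0.
  apply: contra_neq nu0 => u0E; move/eqP: E; rewrite u0E mul0r mulf_eq0 (negPf nv) orbF.
  by move/eqP.
have Hv : (0 < size v)%N by rewrite lt0n size_poly_eq0.
have := leq_size_mulp nu0 nv; rewrite E (leq_size_mulp nu nv0) => E2.
exfalso; lia.
Qed.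

Lemma qsmall_filtration : filtration qsmall.
Proof.
exact: (Filtration qsmall0 qsmallB qsmall_le qsmallM qsmall_scale qsmall_eq0).
Qed.

Lemma qsmall_nat n : qsmall 0 n%:R.
Proof.
exists n%:R, 1; rewrite oner_neq0 addn0 size_poly1; split=> //; first by rewrite rmorph_nat tofrac1 divr1.
by rewrite -polyC_natr size_polyC leq_b1.
Qed.

Lemma q_neq0 : q != 0.
Proof. by rewrite tofrac_eq0 polyX_eq0. Qed.

Lemma qsmall_qV n : qsmall n (q ^- n).
Proof.
exists 1, 'X^n; rewrite monic_neq0 ?monicXn // size_poly1 size_polyXn; split=> //.
by rewrite tofrac1 mul1r tofracXn.
Qed.

Lemma qnum_neq0 n : (0 < n)%N -> qnum n != 0.
Proof.
move=> n0; rewrite /qnum subr_eq0; apply/eqP => E.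
have : q ^+ (n + n) = 1 by rewrite exprD {1}E mulVf // expf_neq0 // q_neq0.
rewrite /q -tofracXn -tofrac1 => /eqP; rewrite tofrac_eq => /eqP /(congr1 (fun p : {poly _} => size p)).
by rewrite size_polyXn size_poly1; lia.
Qed.

Lemma qpart_neq0 mu : 0%N \notin mu -> qpart mu != 0.
Proof.
rewrite /qpart; elim: mu => [|n mu IH]; first by rewrite big_nil oner_neq0.
by rewrite inE negb_or big_cons eq_sym -lt0n => /andP[n0 /IH]; apply: mulf_neq0; apply: qnum_neq0.
Qed.

Lemma adams_inj k p :
  outer_eval Qqt_natr_neq0 (q ^+ k.+1) (t ^+ k.+1) p = 0 -> p = 0.
Proof.
have -> : t ^+ k.+1 = FracField.tofrac ('X^(k.+1))%:P by rewrite /t -tofracXn -polyC_exp.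
by apply: outer_eval_inj; rewrite // size_polyXn.
Qed.

Lemma neg_inj p : outer_eval Qqt_natr_neq0 q (- t) p = 0 -> p = 0.
Proof.
have -> : - t = FracField.tofrac (- 'X)%:P by rewrite /t -tofracN polyCN.
by rewrite -[q]expr1; apply: outer_eval_inj; rewrite // size_polyN size_polyX.
Qed.

(** The Adams operation of index [k.+1]; the shift excludes [k = 0], for which the
    substitution is not defined on fractions. *)
Definition adams k : Qqt -> Qqt := subst_mor (@adams_inj k).
HB.instance Definition _ k := GRing.RMorphism.on (adams k).

Definition negt : Qqt -> Qqt := subst_mor neg_inj.
HB.instance Definition _ := GRing.RMorphism.on negt.

Lemma adamsE k x : (0 < k)%N -> subst x (q ^+ k) (t ^+ k) = adams k.-1 x.
Proof. by case: k. Qed.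

Lemma adams_q k : adams k q = q ^+ k.+1.
Proof. by rewrite /adams /q subst_tofrac outer_evalX. Qed.

Lemma adams_t k : adams k t = t ^+ k.+1.
Proof. by rewrite /adams {1}/t subst_tofrac outer_evalC inner_evalX. Qed.

Lemma negt_q : negt q = q.
Proof. by rewrite /negt {1}/q subst_tofrac outer_evalX. Qed.

Lemma negt_t : negt t = - t.
Proof. by rewrite /negt {1}/t subst_tofrac outer_evalC inner_evalX. Qed.

Lemma adams_adams k l x : adams k (adams l x) = adams (k.+1 * l.+1).-1 x.
Proof.
apply: (rmorph_Qqt_eq (f := adams k \o adams l)); first exact: Qqt_natr_neq0.
  by rewrite /= adams_q rmorphXn /= !adams_q -exprM.
by rewrite /= adams_t rmorphXn /= !adams_t -exprM.
Qed.

(** Since [(-t)^(k+1)] is [-t^(k+1)] or [t^(k+1)] according to the parity. *)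
Lemma negt_adams k x : negt (adams k x) = if odd k.+1 then adams k (negt x) else adams k x.
Proof.
case: ifP => ok.
  apply: (rmorph_Qqt_eq (f := negt \o adams k) (g := adams k \o negt)); first exact: Qqt_natr_neq0.
    by rewrite /= negt_q adams_q rmorphXn /= negt_q.
  by rewrite /= negt_t rmorphN /= adams_t rmorphXn /= negt_t exprNn -signr_odd ok mulN1r.
apply: (rmorph_Qqt_eq (f := negt \o adams k)); first exact: Qqt_natr_neq0.
  by rewrite /= adams_q rmorphXn /= negt_q.
by rewrite /= adams_t rmorphXn /= negt_t exprNn -signr_odd ok mul1r.
Qed.

Lemma adams_qnum k n : adams k (qnum n) = qnum (k.+1 * n).
Proof. by rewrite /qnum rmorphB fmorphV !rmorphXn /= adams_q -!exprM. Qed.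

(** * Normalization: the empty partition *)

Local Notation tofs := (@FracField.tofrac {poly rat}).

Lemma outer_eval_Qs (A B : {poly rat}) p :
  outer_eval Qs_natr_neq0 (tofs A) (tofs B) p = tofs (map_poly (comp_poly B) p).[A].
Proof.
have E (c : {poly rat}) : inner_eval Qs_natr_neq0 (tofs B) c = tofs (c \Po B).
  rewrite /comp_poly -horner_map /inner_eval /horner_eval; congr (_.[_]).
  apply/polyP => i; rewrite !coef_map /=.
  pose h := tofs \o polyC : {rmorphism rat -> Qs}.
  exact/esym/(rat_morph_uniq Qs_natr_neq0 idfun h).
rewrite -horner_map /outer_eval /horner_eval; congr (_.[_]).
by apply/polyP => i; rewrite !coef_map /= E.
Qed.

(** If [n] exceeds the degree in [q], the substitution [q = s^2], [t = s^(4n)]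
    sends distinct monomials to distinct powers of [s]. *)
Lemma outer_eval_Qs_inj n (p : {poly {poly rat}}) : (size p <= n)%N -> (0 < n)%N ->
  outer_eval Qs_natr_neq0 (s ^+ 2) (s ^+ (4 * n)) p = 0 -> p = 0.
Proof.
move=> pn n0; rewrite /s -!tofracXn outer_eval_Qs => /eqP; rewrite tofrac_eq0 => /eqP E.
apply/polyP => i; apply/polyP => j; rewrite !coef0.
have [ni|ip] := leqP (size p) i; first by rewrite [p`_i]nth_default // coef0.
(* [2 * i < 4 * n], so this power of [s] determines [i] and [j]. *)
transitivity ((map_poly (comp_poly 'X^(4 * n)) p).['X^2]`_(4 * n * j + 2 * i)); last by rewrite E coef0.
rewrite (@horner_coef_wide _ n); last first.
  by apply: leq_trans pn; apply: size_poly.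
rewrite coef_sum (bigD1 (Ordinal (leq_trans ip pn))) //= big1 ?addr0.
  rewrite coef_map -exprM coefMXn ltnNge leq_addl /= addnK coef_comp_poly_Xn ?muln_gt0 //.
  by rewrite dvdn_mulr // mulKn // muln_gt0 n0.
move=> k ki; rewrite coef_map -exprM coefMXn; case: ifP => // H.
rewrite coef_comp_poly_Xn ?muln_gt0 ?n0 //; case: ifP => // D.
have {}ki : (k : nat) != i by apply: contraNneq ki => ki; apply/eqP/val_inj.
have kn := ltn_ord k; have ni := leq_trans ip pn.
exfalso; move: D H ki => /dvdnP[m D] H ki; clear E p pn ip.
have E2 : (4 * n * j + 2 * i = m * (4 * n) + 2 * k)%N by lia.
have [mj|mj|mj] := ltngtP m j.
- have : (m.+1 * (4 * n) <= j * (4 * n))%N by rewrite leq_mul2r mj orbT.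
  lia.
- have : (j.+1 * (4 * n) <= m * (4 * n))%N by rewrite leq_mul2r mj orbT.
  lia.
- subst m; lia.
Qed.

Section TrivialModule.
Variable N : nat.

Definition trivial_module : weight_module N 1 :=
  WeightModule (fun _ _ => 0) (fun _ => 0) (fun _ => 0).

Lemma q_weight_trivial la : q_weight trivial_module la = 1.
Proof.
apply/matrixP => i j; rewrite !ord1 !mxE /wform /= big1 ?mulr0 ?expr0z // => k _.
by rewrite mulr0.
Qed.

Lemma mx_simple1 (F : fieldType) (S : 'M[F]_1 -> Prop) : mx_simple S.
Proof.
split=> // U _; have [->|U0] := eqVneq U 0; [by left | right].
by rewrite /row_full eqn_leq rank_leq_col lt0n mxrank_eq0.
Qed.

Lemma is_VA_trivial : is_VA trivial_module [::].
Proof.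
split=> //; last 2 first.
- exact: mx_simple1.
- exists ord0; split; last by move=> i; apply/matrixP => a b; rewrite !mxE.
  by apply/funext => i; rewrite /part_weight nth_nil.
rewrite /gens_of /Uq_relations /=.
have serre0 i j : serre (fun _ : 'I_N => 0 : 'M[Qs]_1) i j = 0.
  by rewrite /serre big1 // => r _; rewrite mulr0 mul0r scaler0.
split.
- by move=> i j; rewrite !q_weight_trivial mulr1 unitmx1.
- by move=> i j; rewrite mulr0 mul0r scaler0.
- by move=> i j; rewrite mulr0 mul0r scaler0.
- move=> i j; rewrite mul0r subr0; case: ifP => // _.
  by rewrite q_weight_trivial (invmx1 _ _ : invmx (1 : 'M[Qs]_1) = 1) subrr scaler0.
- by move=> i j _; rewrite serre0.
Qed.

Lemma lusztig_trivial i (G : generators N 1) : (forall j, genE G j = 0) -> (forall j, genF G j = 0) ->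
  (forall j, genE (lusztig i G) j = 0) /\ (forall j, genF (lusztig i G) j = 0).
Proof.
case: G => E F K /= E0 F0; split=> j; case: ifP => _.
- by rewrite F0 mul0r oppr0.
- by rewrite big1 // => r _; rewrite [E j]E0 mulr0 mul0r scaler0.
- by rewrite E0 mulr0 oppr0.
- by rewrite big1 // => r _; rewrite [F j]F0 mulr0 mul0r scaler0.
Qed.

Lemma mx11_eq1 (A : 'M[Qs]_(1 * 1)) : A ord0 ord0 = 1 -> A = 1.
Proof. by move=> A1; apply/matrixP => i j; rewrite (ord1 i) (ord1 j) A1 mxE. Qed.

Lemma quasi_R_trivial w (G : generators N 1) : (forall j, genE G j = 0) -> (forall j, genF G j = 0) ->
  quasi_R w G = 1.
Proof.
elim: w G => //= i w IH G E0 F0; have [E1 F1] := lusztig_trivial i E0 F0.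
rewrite IH // mulr1 /qexp_factor big_ord_recl big1 ?addr0.
  rewrite E0 F0 !expr0 mulr1 /qfact big_geq // divr1 scale1r.
  by apply: mx11_eq1; rewrite mxE !mxE !ord1 eqxx mulr1.
by move=> k _; rewrite E0 expr0n /= tens0mx scaler0.
Qed.

Lemma R_check_trivial : R_check trivial_module = 1.
Proof.
rewrite /R_check /R_matrix quasi_R_trivial // mulr1.
apply: mx11_eq1; rewrite mxE big_ord1 !mxE /wform /= big1 => [|k _]; last by rewrite mulr0.
by rewrite mulr0 expr0z mulr1n mulr1.
Qed.

Lemma card_tensor_basis m : #|{ffun 'I_m.+1 -> 'I_1}| = 1%N.
Proof. by rewrite card_ffun card_ord exp1n. Qed.

Lemma tensor_mx_eq1 m (A : 'M[Qs]_#|{ffun 'I_m.+1 -> 'I_1}|) : (forall i j, A i j = 1) -> A = 1.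
Proof.
move=> A1; apply/matrixP => i j; rewrite A1 mxE.
have -> : i = j; last by rewrite eqxx.
move: i j {A1 A}; rewrite card_tensor_basis => i j; by rewrite !ord1.
Qed.

Lemma so_trace_trivial m (b : braid m) : so_trace trivial_module [::] b = 1.
Proof.
rewrite /so_trace.
have -> : wform (part_weight [::]) (fun i : 'I_N => part_weight [::] i + two_rho i) = 0.
  by rewrite /wform big1 // => j _; rewrite {1}/part_weight nth_nil mul0r.
rewrite !mulr0 expr0z mul1r q_weight_trivial.
have -> : tensor_power m (1 : 'M[Qs]_1) = 1.
  apply: tensor_mx_eq1 => i j; rewrite mxE big1 // => k _.
  by rewrite mxE !ord1.
rewrite mul1r /braid_op big1; last first.
  move=> [i e] _ /=; rewrite R_check_trivial (invmx1 _ _ : invmx (1 : 'M[Qs]_(1 * 1)) = 1) if_same.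
  apply: tensor_mx_eq1 => x y; rewrite mxE /=.
  have -> : [forall k, [|| k == strandl i, k == strandr i |
     (enum_val x : {ffun 'I_m.+1 -> 'I_1}) k == (enum_val y : {ffun 'I_m.+1 -> 'I_1}) k]].
    by apply/forallP => k; rewrite !ord1 eqxx !orbT.
  by rewrite mulr1 mxE !ord1.
by rewrite mxtrace1 card_tensor_basis.
Qed.

End TrivialModule.

(** The trivial module is [V_A] for the empty partition [A], for every [N]. *)
Lemma W_nil m (b : braid m) (x : Qqt) : is_W_SO b [::] x -> x = 1.
Proof.
move=> [N0 H]; rewrite [x]fracE; set r := generic_quotient.repr x.
pose n := (N0 + size (\n_r - \d_r)).+1.
have := H n _ _ (trivial_module n) (is_VA_trivial n); rewrite so_trace_trivial /subst -/r => {}H.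
have d0 : \d_r != 0 by apply: denom_ratioP.
suff -> : \n_r = \d_r by rewrite divff // tofrac_eq0.
apply/eqP; rewrite -subr_eq0; apply/eqP/(@outer_eval_Qs_inj n).
- exact: leq_trans (leq_addl N0 _) (leqnSn _).
- by [].
have /H : (N0 <= n)%N by apply: leqW; apply: leq_addr.
rewrite !(eval2E Qs_natr_neq0) => E; rewrite rmorphB; apply/eqP; rewrite subr_eq0; apply/eqP.
have e0 : outer_eval Qs_natr_neq0 (s ^+ 2) (s ^+ (4 * n)) \d_r != 0.
  by apply: contra_eq_neq E => ->; rewrite invr0 mulr0 eq_sym oner_eq0.
by rewrite -[LHS](divfK e0) E mul1r.
Qed.

Section BrauerNil.
Notation Qdelta := {fraction {poly rat}}.

Lemma perm0_eq (g h : 'S_0) : g = h.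
Proof. by apply/permP => -[]. Qed.

Lemma trivial_mx_repr : mx_repr [set: 'S_0]%G (fun _ : 'S_0 => 1%:M : 'M[Qdelta]_1).
Proof. by split=> // x y _ _; rewrite /= mulmx1. Qed.

Lemma trivial_brauer_rep : brauer_rep 0 1.
Proof.
by exists (MxRepresentation trivial_mx_repr) (fun _ _ => 0); do ?[by case]; move=> g [].
Qed.

Lemma brS_nil d (rho : brauer_rep 0 d) g : brS rho g = 1%:M.
Proof. by rewrite (perm0_eq g 1%g) repr_mx1. Qed.

(** The Brauer algebra on no points is the base field. *)
Lemma brauer_irreducible_nil d (rho : brauer_rep 0 d) : brauer_irreducible rho -> d = 1%N.
Proof.
case: d rho => [|d] rho [] // _ H.
have [] := H (delta_mx ord0 ord0).
- move=> f [[g ->]|[[]//]]; rewrite brS_nil mulmx1; exact: submx_refl.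
- by move/matrixP/(_ ord0 ord0)/eqP; rewrite !mxE !eqxx oner_eq0.
- by rewrite /row_full mxrank_delta => /eqP <-.
Qed.

Lemma cycle_type_nil (g : 'S_0) : cycle_type g [::].
Proof.
have E : porbits g = finset.set0.
  by apply/finset.setP => C; rewrite finset.in_set0; apply/negP => /imsetP [[]].
by rewrite /cycle_type E enum_set0.
Qed.

Lemma brauer_char_nil : brauer_char [::] [::] = 1.
Proof.
have nat_inj : injective (fun c : int => c%:~R : Qdelta).
  move=> c c' /eqP; rewrite -subr_eq0 -rmorphB /= => H.
  apply/eqP; rewrite -subr_eq0; apply: contraTT H; exact: (intr_neq0 Qs_natr_neq0).
rewrite /brauer_char; apply: xget_unique => [|c].
  exists 1%N, trivial_brauer_rep, 1%g; split.
  - split=> //; first exact: mx_simple1.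
    have one (P : pred 'S_0) : P 1%g -> \sum_(g | P g) brS trivial_brauer_rep g = 1.
      by move=> P1; rewrite (big_pred1 1%g) ?brS_nil // => g /=; rewrite (perm0_eq g 1%g) P1 eqxx.
    have one' (P : pred 'S_0) : P 1%g -> \sum_(g | P g) (-1) ^+ g *: brS trivial_brauer_rep g = 1.
      move=> P1; rewrite (big_pred1 1%g) ?brS_nil ?odd_perm1 ?expr0 ?scale1r // => g /=.
      by rewrite (perm0_eq g 1%g) P1 eqxx.
    rewrite /young_symmetrizer /arcs big_ord0 one ?one' ?mul1r ?mulr1 ?oner_neq0 //;
      by apply/forallP => -[m lt_m0]; have := lt_m0.
  - exact: cycle_type_nil.
  - by rewrite brS_nil mxtrace1.
move=> [d [rho [g [[irr _ _] _]]]]; rewrite brS_nil mxtrace1 (brauer_irreducible_nil irr).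
by move=> E; apply: nat_inj; rewrite -E.
Qed.

End BrauerNil.

(** * The reformulated invariants *)

(** From here on only the morphism properties of the substitutions are used; this
    keeps unification from unfolding them into evaluations of polynomials. *)
Opaque adams negt.

Lemma rmorph_rat_scale (L : fieldType) (f : {rmorphism L -> L}) (a : int) (l : nat) x :
  f (a%:~R / l%:R * x) = a%:~R / l%:R * f x.
Proof. by rewrite rmorphM fmorph_div rmorph_nat rmorph_int. Qed.

Lemma rmorph_natV_scale (L : fieldType) (f : {rmorphism L -> L}) (l : nat) x :
  f (l%:R^-1 * x) = l%:R^-1 * f x.
Proof. by rewrite rmorphM fmorphV rmorph_nat. Qed.

Lemma solve_scaled (L : fieldType) (two z p a h x : L) : two != 0 -> z != 0 -> p != 0 -> a != 0 ->
  z * a ^+ 2 * h / (two * p) = x -> h = two * p / (z * a ^+ 2) * x.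
Proof. by move=> two0 z0 p0 a0 <-; field; rewrite two0 z0 p0 a0. Qed.

Lemma merge_scales (L : fieldType) (m k l x : L) : m * ((k * l)^-1 * x) = k^-1 * (m / l * x).
Proof. by rewrite invfM; ring. Qed.

Lemma adams0 x : adams 0 x = x.
Proof.
apply: (rmorph_Qqt_eq (g := idfun)); first exact: Qqt_natr_neq0.
  by rewrite /= adams_q expr1.
by rewrite /= adams_t expr1.
Qed.

Lemma reform_gE F mu : nonempty_partitions mu ->
  reform_g F mu = \sum_(l <- divisors (gcd_parts mu))
    (moebius l)%:~R / l%:R * adams l.-1 (F (part_div mu l)).
Proof.
move=> pmu; rewrite /reform_g sum_common_divisors //; apply: eq_big_seq => l.
by rewrite -dvdn_divisors ?gcd_parts_gt0 // => /(dvdn_gt0 (gcd_parts_gt0 pmu)) l0; rewrite adamsE.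
Qed.

Lemma common_divisor_gt0 mu k : nonempty_partitions mu -> all (fun i => k %| i)%N mu -> (0 < k)%N.
Proof. by move=> pmu; rewrite -dvdn_gcd_parts; apply/dvdn_gt0/gcd_parts_gt0. Qed.

Lemma mem_divisors_gcd mu k : nonempty_partitions mu ->
  (k \in divisors (gcd_parts mu)) = all (fun i => k %| i)%N mu.
Proof. by move=> pmu; rewrite -dvdn_divisors ?gcd_parts_gt0 // dvdn_gcd_parts. Qed.

(** The inner sums over [l | n] of the Moebius function leave the term [n = 1] only. *)
Lemma reform_gK F mu : nonempty_partitions mu ->
  F mu = \sum_(k <- divisors (gcd_parts mu)) k%:R^-1 * adams k.-1 (reform_g F (part_div mu k)).
Proof.
move=> pmu; have G0 := gcd_parts_gt0 pmu.
transitivity (\sum_(k <- divisors (gcd_parts mu)) \sum_(l <- divisors (gcd_parts mu %/ k))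
  (moebius l)%:~R * ((k * l)%:R^-1 * adams (k * l).-1 (F (part_div mu (k * l))))); last first.
  apply: eq_big_seq => k; rewrite mem_divisors_gcd // => kmu.
  have k0 := common_divisor_gt0 pmu kmu.
  rewrite reform_gE ?gcd_part_div //; last exact: part_div_partition.
  rewrite rmorph_sum mulr_sumr /=; apply: eq_big_seq => l.
  have Gk0 : (0 < gcd_parts mu %/ k)%N by rewrite divn_gt0 // dvdn_leq // dvdn_gcd_parts.
  rewrite -dvdn_divisors // => /(dvdn_gt0 Gk0) l0.
  rewrite (rmorph_rat_scale (adams k.-1)) /= [adams _ (adams _ _)]adams_adams.
  rewrite (prednK k0) (prednK l0) part_divM.
  by rewrite natrM merge_scales.
rewrite (@sum_divisors_divisors _ _ (fun k l =>
  (moebius l)%:~R * ((k * l)%:R^-1 * adams (k * l).-1 (F (part_div mu (k * l)))))) //.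
rewrite (bigD1_seq 1%N) ?divisors_uniq -?dvdn_divisors ?dvd1n //=.
rewrite [X in _ = X + _]big_seq1 divn1 muln1 invr1 mul1r -[1.-1]/0%N adams0.
rewrite (_ : (moebius 1)%:~R = 1 :> Qqt) //.
have -> : part_div mu 1 = mu by rewrite /part_div -[RHS]map_id; apply: eq_map => i; rewrite divn1.
rewrite mul1r big_seq_cond big1 ?addr0 // => n /andP[].
rewrite -dvdn_divisors // => /(dvdn_gt0 G0) n0 n1.
transitivity ((\sum_(l <- divisors n) moebius l)%:~R * (n%:R^-1 * adams n.-1 (F (part_div mu n)))).
  rewrite rmorph_sum mulr_suml; apply: eq_big_seq => l; rewrite -dvdn_divisors // => ln.
  by rewrite divnK.
by rewrite sum_moebius // (negPf n1) mul0r.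
Qed.

(** Only the odd divisors contribute to the part that is odd in [t]. *)
Lemma odd_part_F F mu : nonempty_partitions mu ->
  F mu - negt (F mu) = \sum_(k <- divisors (gcd_parts mu) | odd k)
    k%:R^-1 * adams k.-1 (reform_g F (part_div mu k) - negt (reform_g F (part_div mu k))).
Proof.
move=> pmu; rewrite {1 2}(reform_gK F pmu) rmorph_sum -sumrB [RHS]big_mkcond /=.
apply: eq_big_seq => k; rewrite mem_divisors_gcd // => /(common_divisor_gt0 pmu) k0.
rewrite rmorph_natV_scale /= negt_adams (prednK k0); case: ifP => ok; last by rewrite subrr.
by rewrite rmorphB mulrBr.
Qed.

Definition box (B : nat) : seq int := [seq i%:Z - B%:Z | i <- iota 0 (2 * B).+1].

Lemma box_uniq B : uniq (box B).
Proof. by rewrite map_inj_uniq ?iota_uniq // => i j /addIr []. Qed.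

Lemma mem_box B (beta : int) : beta \notin box B -> (B <= `|beta|)%N.
Proof.
apply: contraR; rewrite -ltnNge => H; apply/mapP; exists `|(beta + B%:Z)%R|%N; last by lia.
by rewrite mem_iota; lia.
Qed.

Definition quantum_poly (nc : nat -> int -> int) (B : nat) : Qqt :=
  \sum_(beta <- box B) \sum_(g <- iota 0 B)
    (nc g beta)%:~R * \sum_(j < g.+1) (q ^ (g%:Z - 2 * j%:Z) * t ^ beta).

Lemma zee_gt0 mu : (0 < zee mu)%N.
Proof.
rewrite /zee big_add1; apply: prodn_gt0 => j.
by rewrite muln_gt0 expn_gt0 fact_gt0.
Qed.

Lemma fsum_bounded (R : nmodType) (f : nat -> int -> R) (B : nat) :
  (forall g beta, (B <= g)%N || (B <= `|beta|)%N -> f g beta = 0) ->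
  \sum_(g \in [set: nat]) \sum_(beta \in [set: int]) f g beta
  = \sum_(beta <- box B) \sum_(g <- iota 0 B) f g beta.
Proof.
move=> fB; rewrite (fsbigE (iota 0 B)) ?iota_uniq //; last first.
  move=> g _; rewrite mem_iota add0n /= -leqNgt => Bg; rewrite fsbig1 // => beta _.
  by rewrite fB // Bg.
rewrite exchange_big; apply: eq_big => [g|g _]; first by rewrite in_setT.
rewrite (fsbigE (box B)) ?box_uniq //; last by move=> beta _ /mem_box H; rewrite fB // H orbT.
by apply: eq_bigl => beta; rewrite in_setT.
Qed.

Lemma fsum_bounded1 (R : nmodType) (f : nat -> R) (B : nat) :
  (forall g, (B <= g)%N -> f g = 0) -> \sum_(g \in [set: nat]) f g = \sum_(g <- iota 0 B) f g.
Proof.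
move=> fB; rewrite (fsbigE (iota 0 B)) ?iota_uniq //; last first.
  by move=> g _; rewrite mem_iota add0n /= -leqNgt => Bg; rewrite fB.
by apply: eq_bigl => g; rewrite in_setT.
Qed.

Definition bounded_by (c : nat -> int -> int) (B : nat) :=
  forall g beta, (B <= g)%N || (B <= `|beta|)%N -> c g beta = 0.

Lemma LMOV_odd_part F (Nc nc : seq nat -> nat -> int -> int) mu B :
  LMOV_SO F Nc -> refined_integers Nc nc -> nonempty_partitions mu ->
  bounded_by (Nc mu) B -> bounded_by (nc mu) B ->
  reform_g F mu - negt (reform_g F mu)
  = 2 * qpart mu / ((zee mu)%:R * qnum 1 ^+ 2) * quantum_poly (nc mu) B.
Proof.
move=> hN hn pmu NB nB; have [_] := hN mu pmu; have [_ E2] := hn mu pmu.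
rewrite (fsum_bounded (B := B)); last by move=> g beta /NB ->; rewrite !mul0r.
set h := reform_g F mu - negt _ => E.
have z0 : (zee mu)%:R != 0 :> Qqt by apply: natr_gt0_neq0; [exact: Qqt_natr_neq0|exact: zee_gt0].
have p0 : qpart mu != 0 by apply: qpart_neq0; case: pmu => /partition_notin0.
have q10 : qnum 1 != 0 by apply: qnum_neq0.
have two0 : 2 != 0 :> Qqt by apply: Qqt_natr_neq0.
rewrite (solve_scaled two0 z0 p0 q10 E); congr (_ * _); rewrite /quantum_poly; apply: eq_bigr => beta _.
rewrite -mulr_suml; have := E2 beta.
rewrite (fsum_bounded1 (B := B)); last by move=> g Bg; rewrite NB ?Bg // mul0r.
rewrite (fsum_bounded1 (B := B)); last by move=> g Bg; rewrite nB ?Bg // mul0r.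
move=> ->; rewrite mulr_suml; apply: eq_bigr => g _.
by rewrite -mulrA mulr_suml.
Qed.

Lemma geometric_qnum (K : fieldType) (x : K) : x != 0 -> 1 - x ^- 2 != 0 ->
  x ^- 2 / (1 - x ^- 2) ^+ 2 = (x - x^-1) ^- 2.
Proof.
move=> x0 h; have x2 : x ^+ 2 - 1 != 0.
  by apply: contraNneq h => E; rewrite -(mulVf (expf_neq0 2 x0)) -{2}[x ^- 2]mulr1 -mulrBr E mulr0.
by field; rewrite x0 -expr2.
Qed.

(** * The product formula *)

Local Notation pw := (@ppow_sum Qqt).

(** The limit that defines the symmetric product exists and is unique. *)
Lemma bracketE mu omega : is_partition mu -> mu <> [::] ->
  bracket omega mu = pexp (bracket_log mu omega).
Proof.
move=> pmu mu0; rewrite /bracket /sprod.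
have H := has_pprod_bracket Qqt_natr_neq0 qsmall_filtration pmu mu0 omega.
apply: xget_unique => // G HG.
exact: (has_pprod_uniq qsmall_filtration HG H).
Qed.

Definition Z_coef (W : seq nat -> Qqt) (mu : seq nat) : Qqt :=
  (zee mu)%:R^-1 * \sum_(A \in brauer_hat (sumn mu)) (brauer_char A mu)%:~R * W A.

Lemma fsum_partitions (D : set (seq nat)) (p : nat -> pseries Qqt) (a : seq nat -> Qqt) e :
  graded p -> D `<=` partitions -> (forall mu, is_partition mu -> ~ D mu -> a mu = 0) ->
  \sum_(mu \in D) a mu * ppbprod p mu e = Psi p a e.
Proof.
move=> gp Dp aD; rewrite (fsbig_widen _ partitions) //=; last first.
  by move=> mu [/= pmu nD]; rewrite (aD mu pmu nD) mul0r.
rewrite (fsbigE (parts (mdeg e))) ?parts_uniq //; first last.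
- move=> mu pmu mue; have [->|/(graded_ppbprod gp (partition_notin0 pmu)) E] := eqVneq (ppbprod p mu e) 0.
    by rewrite mulr0.
  by case/negP: mue; rewrite mem_parts E pmu eqxx.
- by move=> mu /=; rewrite mem_parts => /andP[].
rewrite /Psi big_seq_cond [RHS]big_seq; apply: eq_bigl => mu.
rewrite mem_parts; apply/andP/idP => [[]//|H]; split=> //.
by rewrite inE /=; case/andP: H.
Qed.

Lemma Z_CSE W p : graded p -> Z_CS W p = Psi p (Z_coef W).
Proof.
move=> gp; apply/funext => e.
by apply: (fsum_partitions (a := Z_coef W) e gp).
Qed.

Lemma Z_coef_nil W : W [::] = 1 -> Z_coef W [::] = 1.
Proof.
move=> W1; rewrite /Z_coef (_ : zee [::] = 1%N); last by rewrite /zee big_geq.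
rewrite invr1 mul1r (_ : brauer_hat _ = [set [::]]).
  by rewrite fsbig_set1 W1 mulr1 brauer_char_nil.
apply/seteqP; split=> [A [pA [k /eqP]]|A -> /=]; last by split=> //; exists 0%N.
rewrite addn_eq0 => /andP[/eqP sA _].
have := mem_parts 0 A; rewrite parts0 pA sA eqxx mem_seq1 => /eqP; exact.
Qed.

Lemma rmorph_fsum (I : choiceType) (L : fieldType) (f : {rmorphism L -> L}) (P : set I) (G : I -> L) :
  f (\sum_(i \in P) G i) = \sum_(i \in P) f (G i).
Proof.
rewrite rmorph_sum; suff -> : finite_support 0 P (fun i => f (G i)) = finite_support 0 P G by [].
rewrite /finite_support !unlock; congr (fset_set (_ `&` _) : seq _).
apply/seteqP; split=> i /=; move=> H E; apply: H.
  by rewrite E rmorph0.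
by apply: (fmorph_inj f); rewrite E rmorph0.
Qed.

Lemma negt_Z_coef W mu : negt (Z_coef W mu) = Z_coef (fun A => neg_t (W A)) mu.
Proof.
rewrite /Z_coef (rmorph_natV_scale negt); congr (_ * _).
rewrite (rmorph_fsum negt); apply: eq_fsbigr => A _.
by rewrite rmorphM rmorph_int.
Qed.

Lemma rmorph_log_coefs (f : {rmorphism Qqt -> Qqt}) c F :
  log_coefs c F -> log_coefs (f \o c) (f \o F).
Proof.
move=> [c1 F0 E]; split=> [||la pla]; first exact: etrans (congr1 f c1) (rmorph1 f).
  exact: etrans (congr1 f F0) (rmorph0 f).
have := congr1 f (E la pla); rewrite /weighted /= rmorphM rmorph_nat => ->.
rewrite /conv rmorph_sum; apply: eq_bigr => k _; rewrite rmorph_sum; apply: eq_bigr => mu _.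
rewrite rmorph_sum; apply: eq_bigr => nu _.
by rewrite !rmorphM rmorph_nat.
Qed.

Lemma graded_pbw : graded (pbw : nat -> pseries Qqt).
Proof.
move=> n d n0 H; apply: (graded_ppow_sum (K := Qqt) n0).
by apply: contra_neq H => E; rewrite /pbw /sscale -[pbz n d]/(pw n d) E mulr0.
Qed.

Lemma ppbprod_pbw mu e : ppbprod (pbw : nat -> pseries Qqt) mu e = (qpart mu)^-1 * ppbprod pw mu e.
Proof.
elim: mu e => [|n mu IH] e; first by rewrite /qpart /ppbprod !big_nil invr1 mul1r.
rewrite /qpart /ppbprod !big_cons invfM.
have E1 := @cfM Qqt (pbw n) (ppbprod pbw mu) e.
have E2 := @cfM Qqt (pw n) (ppbprod pw mu) e.
apply: etrans E1 _; apply/esym; apply: etrans (congr1 _ E2) _.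
rewrite mulr_sumr; apply: eq_bigr => d _.
by rewrite IH /pbw /sscale -[pbz n d]/(pw n d) mulrACA.
Qed.

(** The expansion of the logarithm says nothing about the value of [F] at the empty
    partition, whereas a logarithm has constant term 0. *)
Definition remove_nil (F : seq nat -> Qqt) (mu : seq nat) : Qqt := if mu == [::] then 0 else F mu.

Lemma Z_log_coefs W F : W [::] = 1 -> log_expansion (Z_CS W pbz) F ->
  log_coefs (Z_coef W) (remove_nil F).
Proof.
move=> W1 hF; apply: log_coefs_is_log; first exact: Qqt_natr_neq0.
rewrite -Z_CSE; last exact: graded_ppow_sum.
have -> : Psi pw (remove_nil F) = plog (Z_CS W pbz : pseries Qqt).
  rewrite -[RHS]/(slog (Z_CS W pbz)) hF; apply/funext => e.
  rewrite -(@fsum_partitions nonempty_partitions); first last.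
  - move=> mu pmu nmu; rewrite /remove_nil; suff /eqP -> : mu = [::] by [].
    by apply: contrapT => ne; apply: (nmu (conj pmu ne)).
  - by move=> mu [].
  - exact: graded_ppow_sum.
  apply: eq_fsbigr => mu; rewrite inE => -[_ /eqP/negPf ne].
  by rewrite /remove_nil ne.
apply: is_log_plog; first exact: Qqt_natr_neq0.
rewrite -[LHS]/((Z_CS W pw) mset0) Z_CSE; last exact: graded_ppow_sum.
by rewrite Psi_mset0 Z_coef_nil.
Qed.

Lemma is_log_quotient W F : W [::] = 1 -> log_expansion (Z_CS W pbz) F ->
  is_log (sdiv (Z_CS W pbw) (Z_CS (fun A => neg_t (W A)) pbw) : pseries Qqt)
    (Psi pbw (remove_nil F) - Psi pbw (negt \o remove_nil F)).
Proof.
move=> W1 hF; have H := Z_log_coefs W1 hF.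
apply: is_log_pquot.
  by rewrite Z_CSE; [apply: is_log_Psi H|]; apply: graded_pbw.
rewrite Z_CSE; last exact: graded_pbw.
have -> : Z_coef (fun A => neg_t (W A)) = negt \o Z_coef W.
  by apply/funext => mu; rewrite -negt_Z_coef.
by apply: is_log_Psi; [apply: graded_pbw|apply: (rmorph_log_coefs negt)].
Qed.

Definition omega_ (g : nat) (beta : int) (m k : nat) : Qqt :=
  (q^-1) ^ (g%:Z - 2 * k%:Z + 2 * m%:Z) * t ^ beta.

Definition factor_log (mu : seq nat) (n : int) (g : nat) (beta : int) (m : nat) : pseries Qqt :=
  \sum_(k < g.+1) pscale (m%:R * n%:~R / (zee mu)%:R)
    (bracket_log mu (omega_ g beta m k) - bracket_log mu (- omega_ g beta m k)).

Lemma ratr_exponent m n z : (0 < z)%N ->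
  ratr (m%:R * n%:~R / z%:R : rat) = m%:R * n%:~R / z%:R :> Qqt.
Proof.
move=> z0; have := @ratr_frac _ Qqt_natr_neq0 (m%:Z * n) z%:Z.
rewrite !intrM -!pmulrn => -> //; by rewrite -lt0n.
Qed.

Lemma sdivE (f g : series) : sdiv f g = pquot (f : pseries Qqt) g.
Proof. by []. Qed.

Lemma spowE (f : series) r : spow f r = ppow (f : pseries Qqt) r.
Proof. by []. Qed.

Lemma is_log_factor mu n g beta m : is_partition mu -> mu <> [::] ->
  is_log (\big[smul/s1]_(k < g.+1)
     let omega := (q^-1) ^ (g%:Z - 2 * k%:Z + 2 * m%:Z) * t ^ beta in
     spow (sdiv (bracket omega mu) (bracket (- omega) mu)) (m%:R * n%:~R / (zee mu)%:R)
     : pseries Qqt)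
   (factor_log mu n g beta m).
Proof.
move=> pmu mu0; apply: (is_log_prod (K := Qqt)) => k _ /=.
rewrite -/(omega_ g beta m k) (bracketE _ pmu mu0) (bracketE _ pmu mu0).
rewrite -(ratr_exponent _ _ (zee_gt0 mu)) sdivE spowE.
exact (is_log_ppow Qqt_natr_neq0 _
  (is_log_pquot (is_log_bracket Qqt_natr_neq0 _ _) (is_log_bracket Qqt_natr_neq0 _ _))).
Qed.

(** The terms with even exponent [k.+1] are the same for [omega] and [- omega]. *)
Lemma bracket_log_odd (K : fieldType) mu (omega : K) e :
  (bracket_log mu omega - bracket_log mu (- omega)) e
  = \sum_(k < mdeg e | ~~ odd k) 2 / k.+1%:R * omega ^+ k.+1 *
      ppbprod (@ppow_sum K) [seq (k.+1 * n)%N | n <- mu] e.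
Proof.
rewrite cfD cfN /bracket_log -sumrB [RHS]big_mkcond; apply: eq_bigr => k _.
rewrite -mulrBl -mulrBr [(- omega) ^+ _]exprNn -[(-1) ^+ k]signr_odd.
rewrite -[(-1) ^+ k.+1]signr_odd /=; case: (odd k) => /=.
  by rewrite expr0 mul1r subrr mulr0 mul0r.
rewrite expr0 expr1 mulN1r opprK -mulr2n mul1r -[_ *+ 2]mulr_natl mulrA.
by rewrite [_^-1 * 2]mulrC.
Qed.

Lemma regroup (K : fieldType) (m c z d x y p : K) :
  m * c * z * (d * (x * y) * p) = c * z * d * x * p * (m * y).
Proof. by ring. Qed.

Section QuantumPowers.
Variables (K : fieldType) (x u : K).
Hypothesis x0 : x != 0.

Lemma omega_power (a : int) m k :
  ((x^-1) ^ (a + 2 * m%:Z) * u) ^+ k = ((x^-1) ^ a * u) ^+ k * (x ^- (2 * k)) ^+ m.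
Proof.
rewrite expfzDr ?invr_neq0 // -[_ * _ * u]mulrAC exprMn; congr (_ * _).
rewrite -[2 * m%:Z]/((2 * m)%N%:Z) -exprnP exprVn -exprVn -!exprM -exprVn -exprM; congr (_ ^+ _); lia.
Qed.

Lemma sum_quantum_rev (g k : nat) :
  \sum_(j < g.+1) ((x^-1) ^ (g%:Z - 2 * j%:Z) * u) ^+ k
  = \sum_(j < g.+1) (x ^ (g%:Z - 2 * j%:Z) * u) ^+ k.
Proof.
rewrite (reindex_inj rev_ord_inj); apply: eq_bigr => j _; congr ((_ * _) ^+ _).
rewrite exprz_inv; congr (_ ^ _) => /=.
have := ltn_ord j; lia.
Qed.

End QuantumPowers.

Lemma adams_quantum_poly k c B :
  adams k (quantum_poly c B) = \sum_(beta <- box B) \sum_(g <- iota 0 B)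
    (c g beta)%:~R * \sum_(j < g.+1) (q ^ (g%:Z - 2 * j%:Z) * t ^ beta) ^+ k.+1.
Proof.
rewrite /quantum_poly rmorph_sum; apply: eq_bigr => beta _.
rewrite rmorph_sum; apply: eq_bigr => g _.
rewrite rmorphM rmorph_int rmorph_sum; congr (_ * _); apply: eq_bigr => j _.
rewrite rmorphM !fmorphXz /= adams_q adams_t exprMn.
by rewrite !(exprnP _ k.+1) ![(_ ^ k.+1%:Z) ^ _]exprzAC.
Qed.

Lemma adams_qpart k mu : adams k (qpart mu) = qpart [seq (k.+1 * n)%N | n <- mu].
Proof.
by rewrite /qpart rmorph_prod big_map; apply: eq_bigr => n _; rewrite /= adams_qnum.
Qed.

Definition nonempty_parts (n : nat) : seq (seq nat) :=
  undup (flatten [seq parts k | k <- iota 1 n]).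

Lemma mem_nonempty_parts n mu :
  (mu \in nonempty_parts n) = is_partition mu && (0 < sumn mu <= n)%N.
Proof.
rewrite mem_undup; apply/flattenP/andP => [[r /mapP[k kn ->]]|[pmu sn]].
  by rewrite mem_parts => /andP[-> /eqP ->]; move: kn; rewrite mem_iota add1n ltnS.
by exists (parts (sumn mu)); [apply: map_f; rewrite mem_iota add1n ltnS | rewrite mem_parts pmu eqxx].
Qed.

Lemma nonempty_partsP n mu : mu \in nonempty_parts n -> nonempty_partitions mu.
Proof. by rewrite mem_nonempty_parts => /and3P[pmu s0 _]; split=> // E; rewrite E in s0. Qed.

Lemma scaled_sumn k nu : sumn [seq (k * i)%N | i <- nu] = (k * sumn nu)%N.
Proof. by elim: nu => [|i nu IH] /=; rewrite ?muln0 // IH mulnDr. Qed.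

(** Multiplication of the parts by [k] is a bijection onto the partitions of [n]
    all of whose parts are divisible by [k]. *)
Lemma sum_parts_div (R : nmodType) n k (X : seq nat -> R) : (0 < n)%N -> (0 < k)%N ->
  \sum_(mu <- parts n | all (fun i => k %| i)%N mu) X mu
  = \sum_(nu <- nonempty_parts n | (k * sumn nu == n)%N) X [seq (k * i)%N | i <- nu].
Proof.
move=> n0 k0.
rewrite -big_filter -[RHS]big_filter -(big_map (map (muln k)) xpredT X).
apply: perm_big; apply: uniq_perm; first by rewrite filter_uniq ?parts_uniq.
  rewrite map_inj_uniq ?filter_uniq ?undup_uniq //; apply: inj_map => i j /eqP.
  by rewrite eqn_pmul2l // => /eqP.
move=> mu; rewrite mem_filter mem_parts; apply/and3P/mapP => [[kmu pmu /eqP smu]|[nu]].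
  have nmu : nonempty_partitions mu by split=> // E; rewrite -smu E in n0.
  have E := part_divK kmu; have [pd _] := part_div_partition nmu k0 kmu.
  exists (part_div mu k); last by rewrite E.
  have H : (k * sumn (part_div mu k))%N = n by rewrite -scaled_sumn E.
  rewrite mem_filter mem_nonempty_parts pd H eqxx /=; apply/andP; split.
    by rewrite lt0n; apply: contraTneq n0 => s0; rewrite -H s0 muln0.
  by rewrite -H leq_pmull.
rewrite mem_filter => /andP[/eqP kn /nonempty_partsP [pnu nu0]] ->; split.
- by apply/allP => _ /mapP[i _ ->]; apply: dvdn_mulr.
- apply/andP; split; last exact: (scale_notin0 pnu).
  have H : {homo muln k : x y / geq x y} by move=> x y; rewrite /geq /= leq_mul2l => ->; rewrite orbT.
  by apply: homo_sorted H _ _; case/andP: pnu.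
- by rewrite scaled_sumn kn.
Qed.

(** What the factor of index [(mu, g, beta, m)] contributes at [e] to the logarithm,
    through the power sums of index [k.+1 * mu], is this times [m q^(-2(k+1)m)]. *)
Definition product_term (nc : seq nat -> nat -> int -> int) (e : monomial)
    (x : seq nat * nat * int) (k : nat) : Qqt :=
  let: (mu, g, beta) := x in
  (nc mu g beta)%:~R / (zee mu)%:R * (2 / k.+1%:R) *
  (\sum_(j < g.+1) (q ^ (g%:Z - 2 * j%:Z) * t ^ beta) ^+ k.+1) *
  ppbprod pw [seq (k.+1 * n)%N | n <- mu] e.

Lemma factor_logE nc mu g beta m e :
  factor_log mu (nc mu g beta) g beta m e = \sum_(k < mdeg e | ~~ odd k)
    product_term nc e (mu, g, beta) k * (m%:R * (q ^- (2 * k.+1)) ^+ m).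
Proof.
rewrite /factor_log cf_sum /pscale.
under eq_bigr => j _ do rewrite bracket_log_odd mulr_sumr.
rewrite exchange_big; apply: eq_bigr => k _.
under eq_bigr => j _ do rewrite omega_power ?q_neq0 //.
rewrite /product_term -(sum_quantum_rev _ q_neq0) [in RHS]mulr_sumr !mulr_suml.
apply: eq_bigr => j _.
exact: regroup.
Qed.

(** The coefficient of the power sums of index [k * nu] that comes from [nu] in the
    logarithm of the left-hand side. *)
Definition lmov_term (nc : seq nat -> nat -> int -> int) (Bf : seq nat -> nat) (k : nat)
    (nu : seq nat) : Qqt :=
  2 / k%:R / ((zee nu)%:R * qnum k ^+ 2) * adams k.-1 (quantum_poly (nc nu) (Bf nu)).

Lemma cancel_qpart (K : fieldType) (two k p z a x : K) : p != 0 ->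
  k * (two * p / (z * a) * x) / p = two * k / (z * a) * x.
Proof.
move=> p0; move: (z * a)^-1 => w.
by transitivity (two * k * w * x * (p / p)); [ring | rewrite divff // mulr1].
Qed.

Lemma adams_zq (f : {rmorphism Qqt -> Qqt}) (z : nat) p a x :
  f (2 * p / (z%:R * a ^+ 2) * x) = 2 * f p / (z%:R * f a ^+ 2) * f x.
Proof. by rewrite rmorphM fmorph_div !rmorphM !rmorph_nat. Qed.

Lemma ppbprod_scaled_eq0 k nu e : is_partition nu -> (k.+1 * sumn nu)%N != mdeg e ->
  ppbprod pw [seq (k.+1 * i)%N | i <- nu] e = 0.
Proof.
move=> pnu; apply: contra_neq_eq => H; rewrite -scaled_sumn; apply/esym.
by apply: graded_ppbprod H; [apply: graded_ppow_sum|apply: scale_notin0].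
Qed.

Lemma sub_inv_sqr_neq0 (K : fieldType) (x : K) : x != 0 -> x - x^-1 != 0 -> 1 - x ^- 2 != 0.
Proof.
move=> x0; apply: contra_neq => /eqP; rewrite subr_eq0 => /eqP E.
by apply/eqP; rewrite subr_eq0; apply/eqP; rewrite -[LHS]mulr1 E expr2 invfM mulrA divff // mul1r.
Qed.

Lemma q_pow_neq1 k : 1 - q ^- (2 * k.+1) != 0.
Proof.
rewrite mulnC exprM; apply: sub_inv_sqr_neq0; first exact: expf_neq0 q_neq0.
exact: (qnum_neq0 (ltn0Sn k)).
Qed.

Lemma sum_pred1_uniq (R : nmodType) (T : eqType) (r : seq T) i (v : R) : uniq r ->
  \sum_(j <- r | i == j) v = if i \in r then v else 0.
Proof.
move=> ur; case: ifP => ir; last first.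
  by rewrite big_seq_cond big1 // => j /andP[jr /eqP ij]; rewrite ij jr in ir.
rewrite big_mkcond (bigD1_seq i) //= eqxx big1 ?addr0 // => j /negPf.
by rewrite eq_sym => ->.
Qed.

Section Assembly.
Variables (F : seq nat -> Qqt) (Nc nc : seq nat -> nat -> int -> int) (Bf : seq nat -> nat).
Hypothesis hN : LMOV_SO F Nc.
Hypothesis hn : refined_integers Nc nc.
Hypothesis hB : forall mu, nonempty_partitions mu ->
  bounded_by (Nc mu) (Bf mu) /\ bounded_by (nc mu) (Bf mu).

(** The Adams operation of index [k] sends [[mu/k]] to [[mu]], which cancels the
    denominator introduced by [w], and [[1]] to [[k]]. *)
Lemma odd_part_lmov mu : nonempty_partitions mu ->
  (F mu - negt (F mu)) / qpart mu =
  \sum_(k <- divisors (gcd_parts mu) | odd k) lmov_term nc Bf k (part_div mu k).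
Proof.
move=> pmu; rewrite odd_part_F // mulr_suml big_seq_cond [RHS]big_seq_cond.
apply: eq_bigr => k; rewrite mem_divisors_gcd // => /andP[kmu _].
have k0 := common_divisor_gt0 pmu kmu; have pd := part_div_partition pmu k0 kmu.
have [NB nB] := hB pd; rewrite (LMOV_odd_part hN hn pd NB nB) (adams_zq (adams k.-1)) /=.
rewrite adams_qpart adams_qnum (prednK k0) part_divK // muln1.
by apply: cancel_qpart; apply: qpart_neq0; apply: partition_notin0; case: pmu.
Qed.

Lemma log_quotient_coef e :
  (Psi pbw (remove_nil F) - Psi pbw (negt \o remove_nil F)) e
  = \sum_(k < mdeg e | ~~ odd k) \sum_(nu <- nonempty_parts (mdeg e))
      lmov_term nc Bf k.+1 nu * ppbprod pw [seq (k.+1 * i)%N | i <- nu] e.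
Proof.
rewrite cfD cfN /Psi -sumrB; set n := mdeg e.
have [n0|n0] := posnP n.
  rewrite n0 parts0 big_seq1 [RHS]big1; last by move=> [].
  by rewrite /remove_nil /= rmorph0 !mul0r subrr.
transitivity (\sum_(mu <- parts n) \sum_(1 <= k < n.+1 | all (fun i => k %| i)%N mu)
   if odd k then lmov_term nc Bf k (part_div mu k) * ppbprod pw mu e else 0).
  apply: eq_big_seq => mu; rewrite mem_parts => /andP[pmu /eqP smu].
  have nmu : nonempty_partitions mu by split=> // E; rewrite -smu E in n0.
  have ne : (mu == [::]) = false by apply/eqP; case: nmu.
  rewrite -{}smu sum_common_divisors // -big_mkcond -mulr_suml -odd_part_lmov //.
  by rewrite /remove_nil /= ne ppbprod_pbw -mulrBl mulrA.
rewrite (exchange_big_dep xpredT) //= big_add1 big_mkord [RHS]big_mkcond.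
apply: eq_bigr => k _ /=; case: ifP => ok; last by rewrite big1.
rewrite (sum_parts_div _ n0 (ltn0Sn k)) big_mkcond.
apply: eq_big_seq => nu /nonempty_partsP [pnu _]; rewrite scale_part_div //.
case: eqVneq => // ne; by rewrite ppbprod_scaled_eq0 ?mulr0.
Qed.

(** The finitely many [(mu, g, beta)] that matter at monomials of degree [n]. *)
Definition lmov_index n : seq (seq nat * nat * int) :=
  [seq (mu, bg.2, bg.1) | mu <- nonempty_parts n,
     bg <- [seq (beta, g) | beta <- box (Bf mu), g <- iota 0 (Bf mu)]].

Lemma lmov_index_uniq n : uniq (lmov_index n).
Proof.
apply: allpairs_uniq_dep; first exact: undup_uniq.
  by move=> mu _; apply: allpairs_uniq; rewrite ?box_uniq ?iota_uniq // => -[? ?] [? ?].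
by move=> [mu [beta g]] [nu [beta' g']] _ _ /= [-> -> ->].
Qed.

Lemma mem_lmov_index n mu g beta : mu \in nonempty_parts n -> (g < Bf mu)%N ->
  beta \in box (Bf mu) -> (mu, g, beta) \in lmov_index n.
Proof.
move=> mun gB bB; apply/allpairsPdep; exists mu, (beta, g); split=> //.
by apply/allpairsP; exists (beta, g); rewrite mem_iota.
Qed.

Lemma product_term_eq0 e mu g beta k : nonempty_partitions mu ->
  (mu, g, beta) \notin lmov_index (mdeg e) -> product_term nc e (mu, g, beta) k = 0.
Proof.
move=> nmu H; rewrite /product_term; have [pmu mu0] := nmu; have [_ nB] := hB nmu.
have [gB|gB] := leqP (Bf mu) g; first by rewrite nB ?gB // !mul0r.
have [bB|/mem_box bB] := boolP (beta \in box (Bf mu)); last by rewrite nB ?bB ?orbT // !mul0r.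
have mun : mu \notin nonempty_parts (mdeg e) by apply: contraNN H => mun; apply: mem_lmov_index.
rewrite ppbprod_scaled_eq0 ?mulr0 //; apply: contraNneq mun => E.
rewrite mem_nonempty_parts pmu -E leq_pmull // andbT /= lt0n.
apply/eqP => s0; have := leq_size_sumn (partition_notin0 pmu); rewrite s0 leqn0 size_eq0.
by move/eqP.
Qed.

Lemma regroup_sum (K : fieldType) (c z d x p a : K) :
  c / z * d * x * p * a^-1 = d / (z * a) * (c * x) * p.
Proof. by rewrite invfM; ring. Qed.

(** The sum over [m] being replaced by its limit, both sides agree exactly. *)
Lemma sum_product_term e :
  \sum_(x <- lmov_index (mdeg e)) \sum_(k < mdeg e | ~~ odd k)
     product_term nc e x k * (q ^- (2 * k.+1) / (1 - q ^- (2 * k.+1)) ^+ 2)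
  = (Psi pbw (remove_nil F) - Psi pbw (negt \o remove_nil F)) e.
Proof.
rewrite log_quotient_coef exchange_big; apply: eq_bigr => k _.
rewrite big_allpairs_dep; apply: eq_bigr => nu _; rewrite big_allpairs /=.
have -> : q ^- (2 * k.+1) / (1 - q ^- (2 * k.+1)) ^+ 2 = (qnum k.+1 ^+ 2)^-1.
  rewrite mulnC exprM; apply: geometric_qnum; first exact: expf_neq0 q_neq0.
  by rewrite -exprM mulnC q_pow_neq1.
rewrite /lmov_term adams_quantum_poly mulr_sumr mulr_suml; apply: eq_bigr => beta _.
rewrite mulr_sumr mulr_suml; apply: eq_bigr => g _.
exact: regroup_sum.
Qed.

Definition product_index : set (seq nat * nat * int * nat) :=
  [set x | nonempty_partitions x.1.1.1 /\ (1 <= x.2)%N].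

Definition factor_log_at (x : seq nat * nat * int * nat) : pseries Qqt :=
  let: (mu, g, beta, m) := x in factor_log mu (nc mu g beta) g beta m.

Lemma factor_log_atE x e :
  factor_log_at x e = \sum_(k < mdeg e | ~~ odd k)
    product_term nc e x.1 k * (x.2%:R * (q ^- (2 * k.+1)) ^+ x.2).
Proof. by case: x => [[[mu g] beta] m]; apply: factor_logE. Qed.

Lemma sum_factor_log (S : {fset seq nat * nat * int * nat}) e :
  [set` S] `<=` product_index ->
  \sum_(x <- S) factor_log_at x e = \sum_(tau <- lmov_index (mdeg e)) \sum_(k < mdeg e | ~~ odd k)
    product_term nc e tau k * \sum_(x <- S | x.1 == tau) x.2%:R * (q ^- (2 * k.+1)) ^+ x.2.
Proof.
move=> SD; transitivity (\sum_(tau <- lmov_index (mdeg e)) \sum_(x <- S | x.1 == tau) factor_log_at x e).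
  rewrite (exchange_big_dep xpredT) //=; apply: eq_big_seq => x /SD [nmu _].
  rewrite sum_pred1_uniq ?lmov_index_uniq //; case: ifP => // xT.
  rewrite factor_log_atE big1 // => k _; move: nmu xT; case: (x.1) => -[mu g] beta nmu /negbT xT.
  by rewrite product_term_eq0 // mul0r.
apply: eq_bigr => tau _.
under eq_bigr => x _ do rewrite factor_log_atE.
rewrite exchange_big; apply: eq_bigr => k _; rewrite mulr_sumr.
by apply: eq_bigr => x /eqP ->.
Qed.

Lemma qsmall_qpow k n : qsmall n ((q ^- (2 * k.+1)) ^+ n).
Proof.
rewrite -exprVn -exprM exprVn; apply: qsmall_le (qsmall_qV _).
by rewrite leq_pmull.
Qed.

(** For each of the finitely many relevant [(mu, g, beta)] and [k], the partial sums
    over [m] converge. *)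
Lemma tends_factor_log e :
  tends qsmall product_index (fun S => \sum_(x <- S) factor_log_at x e)
    ((Psi pbw (remove_nil F) - Psi pbw (negt \o remove_nil F)) e).
Proof.
rewrite -sum_product_term.
apply: eq_tends => [S SD|]; first exact/esym/sum_factor_log.
rewrite [X in tends _ _ _ X]big_seq.
apply: eq_tends => [S SD|]; first exact/esym/big_seq.
apply: (tends_sum qsmall_filtration) => tau tauT.
apply: (tends_sum qsmall_filtration) => k _.
apply: (tendsM qsmall_filtration); first exact: (tends_cst qsmall_filtration).
apply: (tends_weighted_geometric qsmall_filtration qsmall_nat
  (qsmall_qpow k) _ (ok := fun tau => nonempty_partitions tau.1.1)).
  by rewrite eq_sym -subr_eq0 q_pow_neq1.
case/allpairsPdep: tauT => mu [bg [mun _ ->]]; exact: nonempty_partsP mun.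
Qed.

End Assembly.

Lemma common_bounds (Nc nc : seq nat -> nat -> int -> int) F :
  LMOV_SO F Nc -> refined_integers Nc nc ->
  exists Bf : seq nat -> nat, forall mu, nonempty_partitions mu ->
    bounded_by (Nc mu) (Bf mu) /\ bounded_by (nc mu) (Bf mu).
Proof.
move=> hN hn; have H mu : exists B, nonempty_partitions mu ->
    bounded_by (Nc mu) B /\ bounded_by (nc mu) B.
  have [pmu|] := pselect (nonempty_partitions mu); last by exists 0%N.
  have [[B1 H1] _] := hN mu pmu; have [[B2 H2] _] := hn mu pmu.
  exists (maxn B1 B2) => _; split=> g beta H.
    by apply: H1; case/orP: H => H; apply/orP; [left|right]; apply: leq_trans H; apply: leq_maxl.
  by apply: H2; case/orP: H => H; apply/orP; [left|right]; apply: leq_trans H; apply: leq_maxr.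
by have [Bf hB] := choice H; exists Bf.
Qed.

Theorem mainTheorem3
  (m0 : nat) (b : braid m0) (hb : closure_is_knot b)
  (W : seq nat -> Qqt)
  (hW : forall A : seq nat, is_partition A -> is_W_SO b A (W A))
  (F : seq nat -> Qqt) (hF : log_expansion (Z_CS W pbz) F)
  (Nc nc : seq nat -> nat -> int -> int)
  (hN : LMOV_SO F Nc) (hn : refined_integers Nc nc) :
  has_prod
    [set x : seq nat * nat * int * nat |
       nonempty_partitions x.1.1.1 /\ (1 <= x.2)%N]
    (fun x => let: (mu, g, beta, m) := x in
       \big[smul/s1]_(k < g.+1)
         let omega := (q^-1) ^ (g%:Z - 2 * k%:Z + 2 * m%:Z) * t ^ beta in
         spow (sdiv (bracket omega mu) (bracket (- omega) mu))
              (m%:R * (nc mu g beta)%:~R / (zee mu)%:R))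
    (sdiv (Z_CS W pbw) (Z_CS (fun A => neg_t (W A)) pbw)).
Proof.
have W1 : W [::] = 1 by apply: W_nil; apply: (hW [::]).
have [Bf hB] := common_bounds hN hn.
refine (has_pprod_is_log Qqt_natr_neq0 qsmall_filtration
  (L := factor_log_at nc) _ (is_log_quotient W1 hF) (tends_factor_log hN hn hB)).
by move=> [[[mu g] beta] m] [[pmu mu0] _]; apply: is_log_factor.
Qed.
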